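(* Let $1\le q<\infty$ and $\omega\ge 0$, and let $A$ be an operator on $L^{q}(\Sigma,\mu)$ with dense domain such that $A+\omega I$ is $m$-completely accretive in $L^{q}(\Sigma,\mu)$. Suppose that there are $1\le r\le\infty$, $\varrho\ge 0$, $\sigma>0$, $C>0$ and some $(u_0,0)\in A$ with $u_0\in L^1\cap L^\infty(\Sigma,\mu)$ such that $$\|u-u_0\|_{r}^{\sigma}\le C\,\Big([u-u_0,v]_{q}+\omega\|u-u_0\|_{q}^{q}\Big)\,\|u-u_0\|_{q}^{\varrho}\qquad\text{for every }(u,v)\in A .$$ Then the semigroup $\{T_t\}_{t\ge0}$ generated by $-A$ on $L^{q}(\Sigma,\mu)$ satisfies $$\|T_tu-u_0\|_{r}\le \Big(\tfrac{C}{q}\Big)^{1/\sigma}t^{-\alpha}e^{\omega\beta t}\|u-u_0\|_{q}^{\gamma}$$ for every $t>0$ and $u\in L^{q}(\Sigma,\mu)$, with $\alpha=\frac1\sigma$, $\beta=\gamma+1$, $\gamma=\frac{q+\varrho}{\sigma}$. Moreover, if $1\le r<\infty$ and $\gamma r>q$, then for every $m_0\ge q\gamma^{-1}$ satisfying $$\Big(\tfrac{\gamma r}{q}-1\Big)m_0+q\Big(\tfrac1\gamma-1\Big)>0$$ and every $1\le s\le \gamma r q^{-1}m_0$ satisfying $\gamma^{*}\big(1-\frac{sq}{\gamma r m_0}\big)<1$, one has $$\|T_tu-u_0\|_{\infty}\lesssim t^{-\alpha_s}e^{\omega\beta_s t}\|u-u_0\|_{s}^{\gamma_s}$$ for every $t>0$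 and $u\in L^{s}(\Sigma,\mu)$, with exponents $$\alpha^{*}=\tfrac{\sigma^{-1}q\gamma^{-1}}{(\frac{\gamma r}{q}-1)m_0+q(\frac1\gamma-1)},\quad \beta^{*}=\tfrac{\gamma^{2}rq^{-1}-1}{(\frac{\gamma r}{q}-1)m_0+q(\frac1\gamma-1)}+1,\quad \gamma^{*}=\tfrac{(\gamma rq^{-1}-1)m_0}{(\frac{\gamma r}{q}-1)m_0+q(\frac1\gamma-1)},$$ $$\alpha_s=\tfrac{\alpha^{*}}{1-\gamma^{*}(1-\frac{sq}{\gamma r m_0})},\quad \beta_s=\tfrac{\beta^{*}2^{-1}+\gamma^{*}\frac{sq}{\gamma r m_0}}{1-\gamma^{*}(1-\frac{sq}{\gamma r m_0})},\quad \gamma_s=\tfrac{\gamma^{*}\frac{sq}{\gamma r m_0}}{1-\gamma^{*}(1-\frac{sq}{\gamma r m_0})}.$$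
   Context: $(\Sigma,\mu)$ is a $\sigma$-finite measure space; functions are real-valued; $\|\cdot\|_q$ is the norm of $L^q(\Sigma,\mu)$. An operator $A$ on $L^{q}(\Sigma,\mu)$ is a subset $A\subseteq L^q\times L^q$ (possibly multi-valued), with domain $D(A)=\{u: Au\ne\emptyset\}$ and range $Rg(A)$. The $q$-bracket is $[u,v]_q=\int_\Sigma |u|^{q-2}u\,v\,d\mu$ if $1<q<\infty$, and $[u,v]_1=\int_{\{u\ne0\}}\mathrm{sign}(u)\,v\,d\mu+\int_{\{u=0\}}|v|\,d\mu$. Let $\mathcal J_0$ be the set of convex, lower semicontinuous $j:\mathbb R\to[0,\infty]$ with $j(0)=0$. An operator $B$ is completely accretive if for every $\lambda>0$ the resolvent $J_\lambda=(I+\lambda B)^{-1}$ is a single-valued map on $Rg(I+\lambda B)$ with $\int_\Sigma j(J_\lambda u-J_\lambda\hat u)\,d\mu\le\int_\Sigma j(u-\hat u)\,d\mu$ for all $j\in\mathcal J_0$ and all $u,\hat u\in Rg(I+\lambda B)$. It is $m$-completely accretive in $L^q$ if, in addition, $Rg(I+\lambda B)=L^q(\Sigma,\mu)$ for some (equivalently all) $\lambda>0$. If $A+\omega I$ is $m$-completely accretive in $L^q$, the semigroup generated by $-A$ is $T_tu=\lim_{n\to\infty}(I+\frac tnA)^{-n}u$ in $L^q$, $u\in\overline{D(A)}$. Each $T_t$ is Lipschitz with constant $e^{\omega t}$ with respect to every $L^{s}$-norm; for $u\in L^s(\Sigma,\mu)$, $T_tu$ denotes the value of the unique Lipschitz continuous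 extension of $T_t$ to $L^s(\Sigma,\mu)$. The symbol $\lesssim$ means inequality up to a multiplicative constant independent of $t,u$. *)

(* Defs.v *)
From HB Require Import structures.
From mathcomp Require Import all_boot all_order all_algebra.
From mathcomp Require Import all_classical all_reals all_analysis.
Import Order.TTheory GRing.Theory Num.Theory.
Import numFieldNormedType.Exports.

Set Implicit Arguments.
Unset Strict Implicit.
Unset Printing Implicit Defensive.

Local Open Scope classical_set_scope.
Local Open Scope ring_scope.

(* L^p-norm, in \bar R, of a real-valued function *)
Notation Lpnorm mu p f := (Lnorm mu p (EFin \o f%R)).

Section operators.
Context {d : measure_display} {T : measurableType d} {R : realType}.
Variable mu : {measure set T -> \bar R}.
Implicit Types (A B : set ((T -> R) * (T -> R))) (u v w : T -> R).

(* Elements of L^q are represented by functions in Lfun mu q%:E. A subset of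
   L^q x L^q is represented by its preimage under the passage to classes, that
   is, by a set of pairs that is saturated for a.e. equality. *)
Definition operator_on (q : R) A :=
  (forall u v, A (u, v) -> u \in Lfun mu q%:E /\ v \in Lfun mu q%:E) /\
  (forall u v u' v', A (u, v) ->
     u' \in Lfun mu q%:E -> v' \in Lfun mu q%:E ->
     u = u' %[ae mu] -> v = v' %[ae mu] -> A (u', v')).

Definition domain A : set (T -> R) := [set u | exists v, A (u, v)].

Definition Lclosure (q : R) (D : set (T -> R)) : set (T -> R) :=
  [set u | u \in Lfun mu q%:E /\
     forall e : R, 0 < e ->
       exists2 w, D w & (Lpnorm mu q%:E (u - w) < e%:E)%E].

Definition densely_defined (q : R) A :=
  [set` Lfun mu q%:E] `<=` Lclosure q (domain A).

(* A + omega I *)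
Definition addI (omega : R) A : set ((T -> R) * (T -> R)) :=
  [set (p.1, p.2 + omega *: p.1) | p in A].

(* the graph of (I + lambda B)^-1; its domain is Rg (I + lambda B) *)
Definition resolvent (lambda : R) B : set ((T -> R) * (T -> R)) :=
  [set (p.1 + lambda *: p.2, p.1) | p in B].

(* the graph of (I + lambda B)^-n *)
Fixpoint resolvent_iter (lambda : R) B (n : nat) :
    set ((T -> R) * (T -> R)) :=
  if n is n'.+1 then
    [set p | exists2 z, resolvent lambda B (p.1, z) &
                        resolvent_iter lambda B n' (z, p.2)]
  else diagonal.

Definition bracket (q : R) u v : R :=
  if q == 1 then
    \int[mu]_(x in [set x | u x != 0]) (Num.sg (u x) * v x) +
    \int[mu]_(x in [set x | u x = 0]) `|v x|
  else \int[mu]_x (`|u x| `^ (q - 2) * u x * v x).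

Definition J0 : set (R -> \bar R) :=
  [set j | [/\ (forall x, 0 <= j x)%E, j 0 = 0%E,
     (forall (a : R) x y, 0 <= a <= 1 ->
        (j (a * x + (1 - a) * y)%R <= a%:E * j x + (1 - a)%:E * j y)%E) &
     lower_semicontinuous j]].

Definition completely_accretive B :=
  forall lambda : R, 0 < lambda ->
  forall f u f' u', resolvent lambda B (f, u) -> resolvent lambda B (f', u') ->
    (f = f' %[ae mu] -> u = u' %[ae mu]) /\
    (forall j, J0 j ->
       (\int[mu]_x j (u x - u' x)%R <= \int[mu]_x j (f x - f' x)%R)%E).

Definition m_completely_accretive (q : R) B :=
  [/\ operator_on q B, completely_accretive B &
      exists2 lambda : R, 0 < lambda &
        domain (resolvent lambda B) = [set` Lfun mu q%:E]].

(* S is the semigroup generated by -A on the L^q-closure of D(A). Since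
   (I + (t / n) A)^-1 need not be a map when n is small, the iterates are only
   required to exist for large n. *)
Definition semigroup_generated_by (q : R) A (S : R -> (T -> R) -> (T -> R)) :=
  forall u, Lclosure q (domain A) u ->
    S 0 u = u %[ae mu] /\
    forall t : R, 0 < t -> S t u \in Lfun mu q%:E /\
      exists2 w : nat -> (T -> R),
        (\forall n \near \oo, resolvent_iter (t / n%:R) A n (u, w n)) &
        (Lpnorm mu q%:E (w n - S t u) @[n --> \oo] --> 0)%E.

(* E is a Lipschitz continuous map of L^s that agrees with F on L^q :&: L^s;
   as L^q :&: L^s is dense in L^s for s < +oo, E is unique up to a.e.
   equality. *)
Definition Lipschitz_extension (q s : R) (F E : (T -> R) -> (T -> R)) :=
  [/\ (forall u, u \in Lfun mu s%:E -> E u \in Lfun mu s%:E),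
      (exists2 L : R, 0 <= L &
         forall u v, u \in Lfun mu s%:E -> v \in Lfun mu s%:E ->
           (Lpnorm mu s%:E (E u - E v) <= L%:E * Lpnorm mu s%:E (u - v))%E) &
      (forall u, u \in Lfun mu q%:E -> u \in Lfun mu s%:E ->
         E u = F u %[ae mu])].

End operators.

(* Main.v *)
(* Along the flow, the Gagliardo-Nirenberg type inequality bounds the decay of
   expR (- q omega t) |u(t) - u0|_q^q; for the implicit Euler scheme this is the
   convexity of |.|^q, and letting the step go to 0 gives the L^q - L^r estimate.

   For the L^oo estimate put kappa = gamma r / q > 1. Cutting u - u0 at height
   lam and using that S t is Lipschitz in L^oo gives
     int (|S t u - u0| - e^(omega t) lam)_+^r
       <= M^r t^(-r/sigma) (int (|u - u0| - lam)_+^q)^kappa,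
   and a De Giorgi iteration over levels below delta N, where N bounds
   S (t/2) u - u0 in L^oo, shows that S t u - u0 is bounded by delta N unless N
   is at most
     K (t^(-r/sigma) |u - u0|_s^(s (kappa - 1)))^(1/P), with
   P = r - q + (kappa - 1) (s - q). For delta = 2^(-r/(sigma P)) both alternatives
   agree, and bounded data satisfy the claim for omega t <= 1. Large t is reduced
   to this by waiting in L^s, which costs e^(omega gamma_s t) and is affordable as
   gamma_s < beta_s; general data in L^s are approximated by bounded ones. Only
   the semigroup law at commensurable times is needed, which follows directly
   from the Euler scheme. *)

Require Import Defs.
From HB Require Import structures.
From mathcomp Require Import all_boot all_order all_algebra.
From mathcomp Require Import all_classical all_reals all_analysis.
From mathcomp Require Import measurable_realfun ess_sup_inf ring lra.
Import Order.TTheory GRing.Theory Num.Theory.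
Import numFieldNormedType.Exports.

Set Implicit Arguments.
Unset Strict Implicit.
Unset Printing Implicit Defensive.

Local Open Scope classical_set_scope.
Local Open Scope ring_scope.

(** * Real powers and exponentials *)

(** The operator is abstract, so the equation cannot be tested with a truncation of its solution.
    Truncation acts on the data instead, and the orbit of the truncated datum is compared with the
    original one in L^oo; the levels carry the factor e^(omega t) because this comparison may lose
    that factor. The smoothing estimate leads from L^q to L^r, its iteration needs L^q again, and on
    a space of infinite measure neither norm controls the other. A height N makes the two powers
    comparable between consecutive levels, at a cost geometric in the step number, which the power
    kappa > 1 absorbs. The price is that boundedness is assumed beforehand: the estimate first
    appears as an implication between heights at t/2 and at t, and only its repetition along halved
    times removes the assumed height. *)

Lemma ler_powR2 (R : realType) (p x y : R) :
  0 <= p -> 0 <= x -> x <= y -> x `^ p <= y `^ p.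
Proof.
move=> p0 x0 xy; apply: ge0_ler_powR => //.
by rewrite nnegrE (le_trans x0).
Qed.

Lemma ler_powR2_inv (R : realType) (p x y : R) : 0 < p -> 0 <= x -> 0 <= y ->
  x `^ p <= y `^ p -> x <= y.
Proof.
move=> p0 x0 y0; apply: contraTT; rewrite -!ltNge => yx.
exact: gt0_ltr_powR.
Qed.

Lemma powR_expn (R : realType) (k : nat) (a x : R) : 0 <= a ->
  (a ^+ k) `^ x = (a `^ x) ^+ k.
Proof.
move=> a0; elim: k => [|k IH]; first by rewrite !expr0 powR1.
by rewrite !exprS powRM ?exprn_ge0// IH.
Qed.

Lemma half_powRN (R : realType) (k : nat) (x : R) :
  (2^-1 ^+ k) `^ (- x) = (2 `^ x) ^+ k.
Proof.
have E : 2^-1 `^ (- x) = 2 `^ x.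
  have -> : 2^-1 = 2 `^ (-1) :> R by rewrite powR_inv1.
  by rewrite -powRrM mulN1r opprK.
by rewrite powR_expn ?invr_ge0// E.
Qed.

Lemma powR_half_lt1 (R : realType) (x : R) : 0 < x -> (0 : R) < 2 `^ (- x) < 1.
Proof.
move=> x0; rewrite powR_gt0//= powRN invf_lt1 ?powR_gt0//.
have := @gt0_ltr_powR R x x0 1 2; rewrite powR1; apply; rewrite ?nnegrE//.
by rewrite ltr1n.
Qed.

(** The larger of x and y dominates the product. This is the integrable majorant of the integrand of
    the bracket. *)
Lemma powRB1M_le (R : realType) (q x y : R) : 1 <= q -> 0 <= x -> 0 <= y ->
  x `^ (q - 1) * y <= x `^ q + y `^ q.
Proof.
move=> q1 x0 y0; have q0 : 0 < q by exact: lt_le_trans q1.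
have q10 : 0 <= q - 1 by rewrite subr_ge0.
have [xy|/ltW yx] := leP x y.
  apply: (@le_trans _ _ (y `^ (q - 1) * y)).
    by rewrite ler_wpM2r// ler_powR2.
  by rewrite mulrC mulr_powRB1// lerDr powR_ge0.
apply: (@le_trans _ _ (x `^ (q - 1) * x)).
  by rewrite ler_wpM2l// powR_ge0.
by rewrite mulrC mulr_powRB1// lerDl powR_ge0.
Qed.

(** Young's inequality for y and x^(q-1) with exponents q and q/(q-1) is the tangent line inequality
    of the q-th power, and it covers x = 0 without any derivative. For q = 1 the conjugate exponent
    degenerates, hence the separate case. *)
Lemma powR_tangent (R : realType) (q x y : R) : 1 <= q -> 0 <= x -> 0 <= y ->
  x `^ q + q * x `^ (q - 1) * (y - x) <= y `^ q.
Proof.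
rewrite le_eqVlt => /predU1P[<-|q1] x0 y0.
  by rewrite subrr powRr0 !powRr1// !mul1r addrC subrK.
have q0 : 0 < q by rewrite (lt_trans ltr01).
have qn0 : q != 0 by rewrite gt_eqF.
have q1n0 : q - 1 != 0 by rewrite subr_eq0 gt_eqF.
have q10 : 0 < q - 1 by rewrite subr_gt0.
have := @conjugate_powR R y (x `^ (q - 1)) q (q / (q - 1)) y0 (powR_ge0 _ _) q0.
rewrite divr_gt0// => /(_ isT).
have -> : q^-1 + (q / (q - 1))^-1 = 1 by field; rewrite qn0 q1n0.
move=> /(_ erefl).
rewrite -powRrM mulrCA divff// mulr1 invf_div => H.
have H2 : q * (y * x `^ (q - 1)) <= y `^ q + (q - 1) * x `^ q.
  have -> : y `^ q + (q - 1) * x `^ q = q * (y `^ q / q + x `^ q * ((q - 1) / q)).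
    by field.
  by rewrite ler_pM2l.
have xq : x * x `^ (q - 1) = x `^ q by exact: mulr_powRB1.
by nra.
Qed.

Lemma powR_convex (R : realType) (q a x y : R) : 1 <= q -> 0 <= a <= 1 ->
  0 <= x -> 0 <= y ->
  (a * x + (1 - a) * y) `^ q <= a * x `^ q + (1 - a) * y `^ q.
Proof.
move=> q1 /andP[a0 a1] x0 y0; set m := a * x + _.
have b0 : 0 <= 1 - a by rewrite subr_ge0.
have m0 : 0 <= m by rewrite addr_ge0// mulr_ge0.
have := ler_wpM2l a0 (powR_tangent q1 m0 x0).
have := ler_wpM2l b0 (powR_tangent q1 m0 y0).
set k := q * m `^ (q - 1) => Hy Hx.
apply: le_trans (lerD Hx Hy); rewrite le_eqVlt; apply/orP; left; apply/eqP.
by rewrite /m; ring.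
Qed.

Lemma powR_itv_le (R : realType) (x eta e : R) : 0 < eta -> eta <= x <= 1 ->
  x `^ e <= eta `^ (- `|e|).
Proof.
move=> eta0 /andP[etax x1]; have x0 : 0 < x by exact: lt_le_trans etax.
have eta1 : eta <= 1 by exact: le_trans x1.
have [e0|e0] := leP 0 e.
  apply: (@le_trans _ _ (x `^ 0)); first by apply: ger_powR => //; rewrite x0.
  rewrite powRr0 -(powRr0 eta); apply: ger_powR; first by rewrite eta0.
  by rewrite oppr_le0.
have -> : e = - `|e| by rewrite ltr0_norm ?opprK.
rewrite normrN normr_id !powRN lef_pV2 ?posrE ?powR_gt0//.
by apply: ler_powR2 => //; exact: ltW.
Qed.

(** Exchange of exponents for values in [eta L, L]. The absolute value in the exponent of eta makes
    it work in both directions, p < p' as well as p > p'. *)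
Lemma powR_change_exp (R : realType) (p p' y L eta : R) :
  0 < L -> 0 < eta -> eta * L <= y <= L ->
  y `^ p <= L `^ (p - p') * eta `^ (- `|p - p'|) * y `^ p'.
Proof.
move=> L0 eta0 /andP[etay yL]; have y0 : 0 < y by apply: lt_le_trans etay;
    rewrite mulr_gt0.
have -> : y `^ p = L `^ (p - p') * (y / L) `^ (p - p') * y `^ p'.
  rewrite -powRM ?(ltW L0) ?divr_ge0 ?(ltW y0) ?(ltW L0)//.
  by rewrite [L * _]mulrC divfK ?gt_eqF// -powRD ?subrK// (gt_eqF y0) implybT.
rewrite ler_wpM2r ?powR_ge0// ler_wpM2l ?powR_ge0// powR_itv_le//.
by rewrite ler_pdivlMr// etay ler_pdivrMr// mul1r.
Qed.

(** Rescaling by b / e reduces this to the b-th power of y <= e^y, which produces the constant. It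
    absorbs a polynomial factor in the number of waiting steps. *)
Lemma powR_le_expR (R : realType) (x b e : R) : 0 < x -> 0 < b -> 0 < e ->
  x `^ b <= (b / e) `^ b * expR (e * x).
Proof.
move=> x0 b0 e0.
have -> : x `^ b = (b / e) `^ b * (e * x / b) `^ b.
  rewrite -powRM ?divr_ge0 ?mulr_ge0 ?(ltW x0) ?(ltW b0) ?(ltW e0)//.
  by congr (_ `^ _); field; rewrite !gt_eqF.
rewrite ler_wpM2l ?powR_ge0//.
have -> : expR (e * x) = expR (e * x / b) `^ b by rewrite -expRM divfK ?gt_eqF.
apply: ler_powR2; rewrite ?(ltW b0)// ?divr_ge0 ?mulr_ge0 ?(ltW e0) ?(ltW x0)
    ?(ltW b0)//.
by apply: le_trans (expR_ge1Dx _); rewrite lerDr.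
Qed.

Lemma continuous_norm_powR (R : realType) (p : R) : 0 < p ->
  continuous (fun x : R => `|x| `^ p).
Proof.
move=> p0 x; have [->|x0] := eqVneq x 0; last first.
  suff H : {for `|x|, continuous (fun y : R => y `^ p)}.
    exact: (@continuous_comp R R R Num.norm (fun y : R => y `^ p) x
      (@norm_continuous _ _ x) H).
  apply: differentiable_continuous; apply/derivable1_diffP.
  by apply: derivable_powR; rewrite in_itv/= andbT normr_gt0.
apply/cvgrPdist_lt => e e0.
have d0 : 0 < e `^ p^-1 by rewrite powR_gt0.
have H : \forall y \near (0 : R), `|y| < e `^ p^-1.
  exact: (@cvgr0_norm_lt _ _ _ (nbhs (0 : R)) _ id cvg_id _ d0).
change (\forall y \near (0 : R), Num.norm (Num.norm (0 : R) `^ p - Num.norm y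
    `^ p) < e).
apply: filterS H => y; rewrite normr0 powR0 ?gt_eqF// sub0r normrN.
rewrite (ger0_norm (powR_ge0 _ _)) => ye.
rewrite -[ltRHS]powRr1 ?ltW// -(@mulVf _ p) ?gt_eqF// powRrM.
by apply: gt0_ltr_powR; rewrite ?nnegrE ?powR_ge0.
Qed.

(** With a = x/n one has 1/(1-a) = 1 + a/(1-a) <= e^(a/(1-a)). The margin y - x spares the limit of
    (1 - x/n)^(-n); it is removed at the end of each estimate by [le_expRD]. *)
Lemma euler_pow_le (R : realType) (x y : R) : 0 <= x -> x < y ->
  \forall n \near \oo, x / n%:R < 1 /\ ((1 - x / n%:R)^-1) ^+ n <= expR y.
Proof.
move=> x0 xy; near=> n.
have xn : x < n%:R by near: n; exact: nbhs_infty_gtr.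
have n0 : 0 < n%:R :> R by exact: le_lt_trans xn.
have xn1 : x / n%:R < 1 by rewrite ltr_pdivrMr// mul1r.
(* This threshold is x n / (n - x) <= y solved for n. *)
have yn : y * x / (y - x) <= n%:R by near: n; exact: nbhs_infty_ger.
split => //.
have k0 : 0 < 1 - x / n%:R by rewrite subr_gt0.
apply: (@le_trans _ _ (expR (x / n%:R / (1 - x / n%:R)) ^+ n)).
  apply: lerXn2r; rewrite ?nnegrE ?invr_ge0 ?expR_ge0 ?(ltW k0)//.
  apply: le_trans (expR_ge1Dx _).
  rewrite le_eqVlt; apply/orP; left; apply/eqP; field.
  by rewrite (gt_eqF n0) subr_eq0 gt_eqF.
rewrite -expRM_natl ler_expR.
have -> : n%:R * (x / n%:R / (1 - x / n%:R)) = x * n%:R / (n%:R - x).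
  by field; rewrite (gt_eqF n0) subr_eq0 gt_eqF.
rewrite ler_pdivrMr ?subr_gt0//.
by move: yn; rewrite ler_pdivrMr ?subr_gt0//; nra.
Unshelve. all: by end_near. Qed.

Lemma le_expRD (R : realType) (x : \bar R) (a c : R) :
  (forall e, 0 < e -> (x <= (expR (a + e) * c)%:E)%E) ->
  (x <= (expR a * c)%:E)%E.
Proof.
move=> H.
have fcvg : (fun e => (expR (a + e) * c)%:E) e @[e --> 0^'+] --> (expR a * c)%:E.
  apply/fine_cvgP; split; first exact: nearW.
  have E0 : expR (a + e) * c @[e --> (0 : R)] --> expR (a + 0) * c.
    apply: cvgMl; apply: continuous_cvg; first exact: continuous_expR.
    by apply: cvgD; [exact: cvg_cst|exact: cvg_id].
  by rewrite addr0 in E0; exact: cvg_at_right_filter E0.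
have cf := cvg_lim _ fcvg; rewrite -cf//.
apply: lime_ge; first by apply/cvg_ex; eexists; exact: fcvg.
by near=> e; apply: H; near: e; exact: nbhs_right_gt.
Unshelve. all: by end_near. Qed.

Lemma ecvg0P (R : realType) (u : nat -> \bar R) : (forall n, 0 <= u n)%E ->
  u n @[n --> \oo] --> 0%E <->
  (forall e, 0 < e -> \forall n \near \oo, (u n <= e%:E)%E).
Proof.
move=> u0; split => [ucvg e e0|ue].
  have H : \forall n \near \oo, (u n < e%:E)%E.
    by have := @nbhs_open_ereal_lt _ 0 (cst e) e0; move=> /ucvg.
  by apply: filterS H => n /ltW.
have ufin : \forall n \near \oo, u n \is a fin_num.
  apply: filterS (ue 1 ltr01) => n un; rewrite ge0_fin_numE//.
  by apply: le_lt_trans un _; rewrite ltry.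
apply/fine_cvgP; split => //; apply/cvgr0Pnorm_le => e e0.
apply: filterS2 ufin (ue e e0) => n ufn un.
by rewrite ger0_norm ?fine_ge0//= -lee_fin fineK.
Qed.

(** * Lebesgue norms *)

Section Lnorms.
Context {d : measure_display} {T : measurableType d} {R : realType}.
Variable mu : {measure set T -> \bar R}.
Implicit Types (f g : T -> R) (c p q : R).

Lemma ler_poweR2 (x y : \bar R) (p : R) : 0 < p -> (0 <= x)%E -> (0 <= y)%E ->
  (x `^ p <= y `^ p)%E = (x <= y)%E.
Proof.
move=> p0 x0 y0; apply/idP/idP => [|xy]; last first.
  by apply: (gt0_ler_poweR (ltW p0)) => //; rewrite in_itv/= ?x0 ?y0 leey.
apply: contraLR; rewrite -!ltNge.
case: x x0 => [x x0||//]; case: y y0 => [y y0||//] //.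
- rewrite !poweR_EFin !lte_fin => yx.
  by apply: gt0_ltr_powR => //; rewrite nnegrE -lee_fin.
- by rewrite /= gt_eqF// => _ _; rewrite ltry.
Qed.

Lemma Lnorm_powR_int p f : 0 < p ->
  ((Lpnorm mu p%:E f) `^ p = \int[mu]_x (`|f x| `^ p)%:E)%E.
Proof. by move=> p0; rewrite powR_Lnorm ?gt_eqF. Qed.

Lemma Lnorm_le_int p f c : 0 < p -> 0 <= c ->
  (Lpnorm mu p%:E f <= c%:E)%E =
  (\int[mu]_x (`|f x| `^ p)%:E <= (c `^ p)%:E)%E.
Proof.
move=> p0 c0; by rewrite -Lnorm_powR_int// -poweR_EFin ler_poweR2// ?Lnorm_ge0 ?lee_fin.
Qed.

Lemma Lnorm_lty_int p f : 0 < p ->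
  (Lpnorm mu p%:E f < +oo)%E = (\int[mu]_x (`|f x| `^ p)%:E < +oo)%E.
Proof.
move=> p0; rewrite -Lnorm_powR_int//; apply/idP/idP.
  exact: poweR_lty.
by apply: lty_poweRy; rewrite gt_eqF.
Qed.

Lemma ae_mu0 (P : T -> Prop) : mu setT = 0 -> \forall x \ae mu, P x.
Proof. by move=> mu0; exists setT; split. Qed.

Lemma Lnormy_leP f c : 0 <= c ->
  (Lpnorm mu +oo f <= c%:E)%E <-> \forall x \ae mu, `|f x| <= c.
Proof.
(* On a null space the L^oo norm is 0 by convention, whereas the essential supremum would be -oo. *)
move=> c0; rewrite unlock /=; case: ifPn => [mu0|mu0].
  by split => [/ess_supP|H]; [|apply/ess_supP; move: H]; apply: filterS => x;
    rewrite /= lee_fin.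
split => [_|_]; last by rewrite lee_fin.
apply: ae_mu0; apply/eqP; rewrite eq_le measure_ge0 andbT leNgt//.
Qed.

Lemma Lfun_measurable (p : \bar R) f : f \in Lfun mu p -> measurable_fun setT f.
Proof. by move=> /andP[]; rewrite inE. Qed.

Lemma Lfun_norm_lty (p : \bar R) f : f \in Lfun mu p -> (Lpnorm mu p f < +oo)%E.
Proof. by move=> /andP[_]; rewrite inE. Qed.

Lemma LfunI (p : \bar R) f : measurable_fun setT f -> (Lpnorm mu p f < +oo)%E ->
  f \in Lfun mu p.
Proof. by move=> mf ff; apply/andP; rewrite !inE. Qed.

Lemma Lfun_norm_fineK (p : \bar R) f : f \in Lfun mu p ->
  ((fine (Lpnorm mu p f))%:E = Lpnorm mu p f)%E.
Proof. by move=> /Lfun_norm_lty ff; rewrite fineK// ge0_fin_numE ?Lnorm_ge0. Qed.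

Lemma LfunD (p : \bar R) f g : (1 <= p)%E -> f \in Lfun mu p -> g \in Lfun mu p ->
  f + g \in Lfun mu p.
Proof. by move=> p1; have [_ +] := Lfun_addr_closed mu p1; exact. Qed.

Lemma LfunB (p : \bar R) f g : (1 <= p)%E -> f \in Lfun mu p -> g \in Lfun mu p ->
  f - g \in Lfun mu p.
Proof. by move=> p1 fp gp; apply: LfunD => //; exact: Lfun_oppr_closed. Qed.

Lemma LnormN (p : \bar R) f : Lpnorm mu p (- f) = Lpnorm mu p f.
Proof. by rewrite -[RHS]oppe_Lnorm. Qed.

Lemma measurable_norm_powR f p : measurable_fun setT f ->
  measurable_fun setT (fun x => (`|f x| `^ p)%:E).
Proof.
move=> mf; apply/measurable_EFinP.
by apply: (measurableT_comp (measurable_powR p)); exact: measurableT_comp.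
Qed.

Lemma le_Lnorm (p : \bar R) f g c : (1 <= p)%E -> 0 <= c ->
  measurable_fun setT f -> measurable_fun setT g ->
  (\forall x \ae mu, `|f x| <= `|g x|) ->
  (Lpnorm mu p g <= c%:E)%E -> (Lpnorm mu p f <= c%:E)%E.
Proof.
move=> + c0 mf mg fg; case: p => [p||//] p1; last first.
  move=> /(Lnormy_leP g c0) gc; apply/Lnormy_leP => //.
  by apply: filterS2 fg gc => x; exact: le_trans.
have p0 : 0 < p by rewrite (lt_le_trans ltr01)// -lee_fin.
rewrite (Lnorm_le_int f p0 c0) (Lnorm_le_int g p0 c0); apply: le_trans.
apply: ae_ge0_le_integral => //.
- exact: measurable_norm_powR.
- exact: measurable_norm_powR.
by apply: filterS fg => x fg _; rewrite lee_fin ler_powR2// ltW.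
Qed.

Lemma Lnorm_le_eq0 (p : \bar R) f : (1 <= p)%E -> measurable_fun setT f ->
  (Lpnorm mu p f <= 0%:E)%E -> f = (fun=> 0) %[ae mu].
Proof.
move=> p1 mf f0.
have /(Lnorm_eq0_eq0 _ _) : (Lpnorm mu p f = 0)%E.
  by apply/eqP; rewrite eq_le f0 Lnorm_ge0.
move=> /(_ _ _)-H; have {H} : EFin \o f = \0%E %[ae mu].
  apply: H; first exact/measurable_EFinP.
  by rewrite (lt_le_trans _ p1)// lte_fin.
by apply: filterS => x /= /(_ I)[] ->.
Qed.

Lemma Lnorm_triangle (p : \bar R) f g a b : (1 <= p)%E ->
  measurable_fun setT f -> measurable_fun setT g ->
  (Lpnorm mu p f <= a%:E)%E -> (Lpnorm mu p g <= b%:E)%E ->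
  (Lpnorm mu p (f + g) <= (a + b)%:E)%E.
Proof.
move=> p1 mf mg fa gb; rewrite EFinD.
by apply: le_trans (eminkowski _ mf mg p1) _; exact: leeD.
Qed.

Lemma Lnorm_subr_subr (p : \bar R) (f g f' g' : T -> R) (a b : R) :
  (1 <= p)%E -> measurable_fun setT f -> measurable_fun setT g ->
  measurable_fun setT f' -> measurable_fun setT g' ->
  (Lpnorm mu p (f - f') <= a%:E)%E -> (Lpnorm mu p (g - g') <= b%:E)%E ->
  (Lpnorm mu p ((f - g) - (f' - g')) <= (a + b)%:E)%E.
Proof.
move=> p1 mf mg mf' mg' fa gb.
have -> : (f - g) - (f' - g') = (f - f') + - (g - g') by apply/funext => x /=;
    rewrite !fctE; ring.
apply: Lnorm_triangle => //; last by rewrite LnormN.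
- exact: measurable_funB.
- by apply: measurable_funN; exact: measurable_funB.
Qed.

Lemma Lfun_eq_ae (p : \bar R) f g : (1 <= p)%E ->
  f \in Lfun mu p -> g \in Lfun mu p ->
  (forall e, 0 < e -> (Lpnorm mu p (f - g) <= e%:E)%E) -> f = g %[ae mu].
Proof.
move=> p1 fp gp H.
have mfg : measurable_fun setT (f - g).
  by apply: measurable_funB; apply: Lfun_measurable; eassumption.
have /(Lnorm_le_eq0 p1 mfg) : (Lpnorm mu p (f - g) <= 0%:E)%E.
  by apply/lee_addgt0Pr => e e0; rewrite add0e; exact: H.
apply: filterS => x /(_ I) fg _.
by apply/eqP; rewrite -subr_eq0; apply/eqP.
Qed.

End Lnorms.

Lemma fine_Lnorm_ge0 {d} {T : measurableType d} {R : realType}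
    (mu : {measure set T -> \bar R}) (p : \bar R) (f : T -> R) :
  0 <= fine (Lpnorm mu p f).
Proof. by rewrite fine_ge0// Lnorm_ge0. Qed.

Lemma Lfun1_oo (d : measure_display) (T : measurableType d) (R : realType)
    (mu : {measure set T -> \bar R}) (s : R) (f : T -> R) : 1 <= s ->
  f \in Lfun mu 1 -> f \in Lfun mu +oo -> f \in Lfun mu s%:E.
Proof.
move=> s1 f1 foo; have s0 : 0 < s by exact: lt_le_trans s1.
have mf := Lfun_measurable f1.
set L := fine (Lpnorm mu +oo f).
have L0 : 0 <= L by exact: fine_Lnorm_ge0.
have /(Lnormy_leP _ _ L0) fL : (Lpnorm mu +oo f <= L%:E)%E by rewrite Lfun_norm_fineK.
apply: LfunI => //; rewrite Lnorm_lty_int//.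
have f1y : (\int[mu]_x (`|f x| `^ 1)%:E < +oo)%E.
  by rewrite -Lnorm_lty_int//; exact: Lfun_norm_lty f1.
apply: (@le_lt_trans _ _ ((L `^ (s - 1))%:E * \int[mu]_x (`|f x| `^ 1)%:E)%E);
    last first.
  by rewrite lte_mul_pinfty// lee_fin powR_ge0.
rewrite -ge0_integralZl_EFin ?powR_ge0//; last exact: measurable_norm_powR.
apply: ae_ge0_le_integral => //.
- exact: measurable_norm_powR.
- by move=> x _; rewrite -EFinM lee_fin mulr_ge0 ?powR_ge0.
- by apply: emeasurable_funM => //; exact: measurable_norm_powR.
apply: filterS fL => x fL _; rewrite -EFinM lee_fin powRr1//.
rewrite -(mulr_powRB1 (normr_ge0 (f x)) s0) mulrC ler_wpM2r//.
by rewrite ler_powR2 ?subr_ge0.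
Qed.

(** * Almost everywhere convergent subsequences and lower semicontinuity of norms *)

Section convergence.
Context {d : measure_display} {T : measurableType d} {R : realType}.
Variable mu : {measure set T -> \bar R}.

(** The indices are chosen so that the integrals of |f|^q are summable; the series of |f|^q is then
    finite a.e. and its terms tend to 0. *)
Lemma Lnorm_cvg0_ae_subseq (q : R) (f_ : nat -> T -> R) : 1 <= q ->
  (forall n, measurable_fun setT (f_ n)) ->
  Lpnorm mu q%:E (f_ n) @[n --> \oo] --> 0%E ->
  exists2 k : nat -> nat, (forall n, n <= k n)%N &
    \forall x \ae mu, f_ (k n) x @[n --> \oo] --> 0.
Proof.
move=> q1 mf f0; have q0 : 0 < q by exact: lt_le_trans q1.
have /choice[k kP] : forall n, exists m, (n <= m)%N /\
    (\int[mu]_x (`|f_ m x| `^ q)%:E <= (1 / (2 ^ n.+1)%:R)%:E)%E.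
  move=> n; set e := 1 / _.
  have e0 : 0 < e by rewrite divr_gt0// ltr0n expn_gt0.
  have ep : 0 < e `^ q^-1 by rewrite powR_gt0.
  have : \forall m \near \oo, (Lpnorm mu q%:E (f_ m) <= (e `^ q^-1)%:E)%E.
    exact: ((ecvg0P (fun n => Lnorm_ge0 _ _ _)).1 f0 _ ep).
  move=> /(filterI (nbhs_infty_ge n))/filter_ex[m [nm]].
  rewrite Lnorm_le_int ?powR_ge0// -powRrM mulVf ?gt_eqF// (powRr1 (ltW e0)) => H.
  by exists m.
exists k; first by move=> n; have [] := kP n.
pose g n x := (`|f_ (k n) x| `^ q)%:E.
have mg n : measurable_fun setT (g n) by exact: measurable_norm_powR.
have g0 n x : (0 <= g n x)%E by rewrite lee_fin powR_ge0.
have gfin : (\int[mu]_x (\sum_(n <oo) g n x) < +oo)%E.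
  rewrite integral_nneseries//.
  apply: (@le_lt_trans _ _ 1%:E); last exact: ltry.
  apply: le_trans (epsilon_trick0 xpredT ler01).
  apply: lee_nneseries => n _ //; first by move=> _; exact: integral_ge0.
  by have [] := kP n.
have : {ae mu, forall x, setT x -> (\sum_(n <oo) g n x)%E \is a fin_num}.
  apply: integrable_ae => //; apply/integrableP; split.
    exact: ge0_emeasurable_sum.
  under eq_integral do rewrite gee0_abs ?nneseries_ge0//.
  by [].
apply: filterS => x /(_ I) sfin.
have sy : (\sum_(0 <= n <oo) g n x < +oo)%E by rewrite -ge0_fin_numE ?nneseries_ge0.
have tail := nneseries_tail_cvg sy (fun n _ => g0 n x).
have gcvg : g n x @[n --> \oo] --> 0%E.
  apply: squeeze_cvge tail; last exact: cvg_cst.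
  apply: nearW => n; rewrite g0/=.
  apply: le_trans (@nneseries_lim_ge _ _ xpredT n n.+1 _).
    by rewrite big_nat1.
  by [].
have {}gcvg : `|f_ (k n) x| `^ q @[n --> \oo] --> (0 : R).
  exact: (fine_cvg gcvg).
apply/cvgr0Pnorm_lt => e e0.
have eq0 : 0 < e `^ q by rewrite powR_gt0.
have H := @cvgr0_norm_lt _ _ _ \oo _ _ gcvg _ eq0.
apply: filterS (H _) => n; rewrite (ger0_norm (powR_ge0 _ _)).
apply: contraTT; rewrite -!leNgt => hn; apply: ler_powR2 => //; exact: ltW.
Qed.

(** Convergence is measured in L^q and the bound in another L^p, p = +oo included: an a.e.
    convergent subsequence and Fatou's lemma connect the two. Every bound on the Euler scheme passes
    to the semigroup through this lemma. *)
Lemma Lnorm_lsc (q c : R) (p : \bar R) (f_ : nat -> T -> R) (f : T -> R) :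
  1 <= q -> (1 <= p)%E -> 0 <= c -> measurable_fun setT f ->
  (\forall n \near \oo,
    measurable_fun setT (f_ n) /\ (Lpnorm mu p (f_ n) <= c%:E)%E) ->
  (forall e, 0 < e ->
    \forall n \near \oo, (Lpnorm mu q%:E (f_ n - f) <= e%:E)%E) ->
  (Lpnorm mu p f <= c%:E)%E.
Proof.
move=> q1 p1 c0 mf [N _ fN] fe.
wlog : f_ N fN fe / N = 0%N.
  move=> H; apply: (H (fun n => f_ (n + N)%N) 0%N) => //.
    by move=> n _; apply: fN; rewrite /= leq_addl.
  move=> e /fe[M _ fM]; exists M => // n /= Mn; apply: fM.
  by rewrite /= (leq_trans Mn)// leq_addr.
move=> N0; rewrite {N}N0 in fN.
have mf_ n : measurable_fun setT (f_ n) by have [] := fN n (leq0n n).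
have fc n : (Lpnorm mu p (f_ n) <= c%:E)%E by have [] := fN n (leq0n n).
have fcvg : Lpnorm mu q%:E (f_ n - f) @[n --> \oo] --> 0%E.
  by apply: (ecvg0P (fun n => Lnorm_ge0 _ _ _)).2 => e; exact: fe.
have mff n : measurable_fun setT (f_ n - f) by exact: measurable_funB.
have [k nk fkx] := Lnorm_cvg0_ae_subseq q1 mff fcvg.
pose g n := f_ (k n).
have gc n : (Lpnorm mu p (g n) <= c%:E)%E by exact: fc.
have {}fkx : \forall x \ae mu, g n x @[n --> \oo] --> f x.
  apply: filterS fkx => x fkx.
  by apply/subr_cvg0.
case: p p1 fc gc {fN} => [p||//] p1 fc gc; last first.
  apply/Lnormy_leP => //.
  have {}gc : \forall x \ae mu, forall n, `|g n x| <= c.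
    by apply/ae_foralln => n; apply/Lnormy_leP.
  apply: filterS2 fkx gc => x gf gc.
  rewrite leNgt; apply/negP => cf.
  have [n] := filter_ex (cvgr_gt _ (cvg_norm gf) _ cf).
  by rewrite /= ltNge gc.
have p0 : 0 < p by rewrite (lt_le_trans ltr01)// -lee_fin.
rewrite Lnorm_le_int//.
have mg n : measurable_fun setT (fun x => (`|g n x| `^ p)%:E).
  exact: measurable_norm_powR (mf_ _).
apply: (@le_trans _ _ (limn_einf (fun n => \int[mu]_x (`|g n x| `^ p)%:E)%E));
    last first.
  rewrite limn_einf_lim; apply: lime_le; first exact: is_cvg_einfs.
  apply: nearW => n; apply: (@le_trans _ _ (\int[mu]_x (`|g n x| `^ p)%:E)%E).
    by apply: ereal_inf_lbound; exists n => /=.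
  by have := gc n; rewrite Lnorm_le_int.
apply: le_trans (fatou mu measurableT mg _); last first.
  by move=> n x _; rewrite lee_fin powR_ge0.
rewrite le_eqVlt; apply/orP; left; apply/eqP.
apply: ge0_ae_eq_integral => //.
- exact: measurable_norm_powR.
- have -> : (fun x => limn_einf (fun n => (`|g n x| `^ p)%:E)) =
      (fun x => - limn_esup (fun n => (- (`|g n x| `^ p)%:E)))%E.
    by apply/funext => x; rewrite -limn_einfN; congr limn_einf;
      apply/funext => n /=; rewrite opprK.
  apply: measurableT_comp => //; apply: measurable_fun_limn_esup => n.
  exact: measurableT_comp.
- move=> x _; rewrite limn_einf_lim; apply: lime_ge; first exact: is_cvg_einfs.
  by apply: nearW => n; apply: le_ereal_inf_tmp => _ [m _ <-]; rewrite lee_fin powR_ge0.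
apply: filterS fkx => x gf _.
have : (`|g n x| `^ p)%:E @[n --> \oo] --> (`|f x| `^ p)%:E.
  apply/fine_cvgP; split; first exact: nearW.
  exact: (cvg_comp _ _ gf (@continuous_norm_powR _ p p0 (f x))).
by move=> /cvg_limn_einf_sup[->].
Qed.

End convergence.

(** * The q-bracket as a one-sided derivative *)

Section bracket.
Context {d : measure_display} {T : measurableType d} {R : realType}.
Variable mu : {measure set T -> \bar R}.

Lemma fine_Lnorm_powR (q : R) (f : T -> R) : 1 <= q ->
  fine (Lpnorm mu q%:E f) `^ q = \int[mu]_x (`|f x| `^ q).
Proof.
move=> q1; rewrite /Rintegral -Lnorm_powR_int ?(lt_le_trans ltr01)//.
by rewrite fine_poweR.
Qed.

(** The function g is 1/q times the right derivative of |a + h v|^q at h = 0, so convexity bounds it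
    by the difference quotient. For q = 1 the second integral of the bracket supplies this
    derivative on the set where a vanishes, namely |v|. *)
Lemma bracket_Rintegral (q : R) (a v : T -> R) : 1 <= q ->
  a \in Lfun mu q%:E -> v \in Lfun mu q%:E ->
  exists g, [/\ mu.-integrable setT (EFin \o g),
    bracket mu q a v = \int[mu]_x g x &
    forall h x, 0 < h -> `|a x| `^ q + q * h * g x <= `|a x + h * v x| `^ q].
Proof.
move=> q1 aq vq; have q0 : 0 < q by exact: lt_le_trans q1.
have ma := Lfun_measurable aq; have mv := Lfun_measurable vq.
have dom (g : T -> R) : measurable_fun setT g ->
    (forall x, `|g x| <= `|a x| `^ q + `|v x| `^ q) ->
    mu.-integrable setT (EFin \o g).
  move=> mg gle; have := integrableD measurableT (Lfun_integrable q1 aq)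
    (Lfun_integrable q1 vq).
  apply: le_integrable => //; first exact/measurable_EFinP.
  move=> x _ /=; rewrite lee_fin (ger0_norm (addr_ge0 _ _)) ?powR_ge0//.
rewrite /bracket; case: ifPn => [/eqP q_eq1|qn1].
  have mN : measurable [set x | a x != 0].
    rewrite (_ : [set x | a x != 0] = a @^-1` [set~ 0]).
      by rewrite -[X in measurable X]setTI; apply: ma => //; exact: measurableC.
    by apply/seteqP; split => x /= /eqP.
  have mZ : measurable [set x | a x = 0].
    by rewrite -[X in measurable X]setTI; apply: (ma _ [set 0]).
  pose g1 := (fun x => Num.sg (a x) * v x) \_ [set x | a x != 0].
  pose g2 := (fun x => `|v x|) \_ [set x | a x = 0].
  have g1E x : g1 x = Num.sg (a x) * v x.
    rewrite /g1 patchE; case: ifPn => //.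
    by rewrite notin_setE /= => /negP; rewrite negbK => /eqP ->; rewrite sgr0 mul0r.
  have g2E x : g2 x = if a x == 0 then `|v x| else 0.
    rewrite /g2 patchE; case: ifPn; first by rewrite inE /= => ->; rewrite eqxx.
    by rewrite notin_setE /= => /eqP/negPf ->.
  have mg1 : measurable_fun setT g1.
    rewrite (_ : g1 = (fun x => Num.sg (a x) * v x)); last exact/funext.
    apply: measurable_funM => //; apply: (measurableT_comp _ ma).
    rewrite (_ : Num.sg = fun y : R => if 0 < y then 1 else if y < 0 then - 1 else 0).
      apply: measurable_fun_ifT => //; first exact: measurable_fun_ltr.
      by apply: measurable_fun_ifT => //; exact: measurable_fun_ltr.
    by apply/funext => y; case: sgrP.
  have mg2 : measurable_fun setT g2.
    apply/(measurable_restrictT _ _).1 => //.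
    by apply: measurable_funTS; exact: measurableT_comp.
  have v1 x : `|v x| = `|v x| `^ q by rewrite q_eq1 powRr1.
  have i1 : mu.-integrable setT (EFin \o g1).
    apply: dom => // x; rewrite g1E normrM normr_sg.
    by case: eqP => _ /=; rewrite ?mul0r ?mul1r ?addr_ge0 ?powR_ge0// -v1 lerDr
        powR_ge0.
  have i2 : mu.-integrable setT (EFin \o g2).
    apply: dom => // x; rewrite g2E.
    by case: ifP => _ ; rewrite ?normr0 ?normr_id ?addr_ge0 ?powR_ge0// -v1
        lerDr powR_ge0.
  exists (g1 \+ g2); split.
  - exact: (integrableD measurableT i1 i2).
  - by rewrite Rintegral_mkcond [X in _ + X]Rintegral_mkcond RintegralD.
  - move=> h x h0; rewrite q_eq1 !powRr1// mul1r /= g1E g2E.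
    case: eqVneq => [->|_]; first by rewrite sgr0 normr0 !add0r mul0r add0r
        normrM gtr0_norm.
    rewrite addr0.
    have [a0|a0|->] := ltrgt0P (a x).
    - by rewrite gtr0_sg// mul1r ler_norm.
    - rewrite ltr0_sg// mulN1r.
      by have := ler_norm (- (a x + h * v x)); rewrite normrN; lra.
    - by rewrite sgr0 mul0r mulr0 add0r normr_ge0.
have {qn1 q1} q1 : 1 < q by rewrite lt_neqAle eq_sym qn1.
exists (fun x => `|a x| `^ (q - 2) * a x * v x).
have gle x : `| `|a x| `^ (q - 2) * a x * v x| = `|a x| `^ (q - 1) * `|v x|.
  rewrite !normrM (ger0_norm (powR_ge0 _ _)); congr (_ * _).
  rewrite mulrC (_ : q - 2 = (q - 1) - 1); last by ring.
  by rewrite mulr_powRB1// subr_gt0.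
split => //.
- apply: dom; last by move=> x; rewrite gle powRB1M_le// ltW.
  apply: measurable_funM => //; apply: measurable_funM => //.
  by apply: (measurableT_comp (measurable_powR _)); exact: measurableT_comp.
- move=> h x h0; apply: le_trans (powR_tangent (ltW q1) (normr_ge0 (a x))
    (normr_ge0 _)).
  rewrite lerD2l -!mulrA ler_pM2l//.
  have [->|a0] := eqVneq (a x) 0.
    by rewrite normr0 !(mul0r, mulr0) powR0 ?mul0r// gt_eqF// subr_gt0.
  have -> : `|a x| `^ (q - 1) = `|a x| `^ (q - 2) * `|a x|.
    rewrite mulrC (_ : q - 2 = (q - 1) - 1); last by ring.
    by rewrite mulr_powRB1// subr_gt0.
  have p0 : 0 <= `|a x| `^ (q - 2) by exact: powR_ge0.
  have : a x * (h * v x) <= `|a x| * (`|a x + h * v x| - `|a x|).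
    rewrite mulrBr -normrM -expr2 real_normK ?num_real//.
    have := ler_norm (a x * (a x + h * v x)); lra.
  by move=> /(ler_wpM2l p0); lra.
Qed.

(** For a resolvent step f = u + h v it is used with a = u - u0, so that a + h v = f - u0. *)
Lemma bracket_le (q h : R) (a v : T -> R) : 1 <= q -> 0 < h ->
  a \in Lfun mu q%:E -> v \in Lfun mu q%:E -> a + h *: v \in Lfun mu q%:E ->
  fine (Lpnorm mu q%:E a) `^ q + q * h * bracket mu q a v <=
  fine (Lpnorm mu q%:E (a + h *: v)) `^ q.
Proof.
move=> q1 h0 aq vq bq.
have [g [ig -> gle]] := bracket_Rintegral q1 aq vq.
rewrite !fine_Lnorm_powR// -RintegralZl// -RintegralD//; last 2 first.
- exact: Lfun_integrable.
- exact: (integrableZl measurableT (q * h) ig).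
apply: le_Rintegral => //.
- exact: (integrableD measurableT (Lfun_integrable q1 aq)
    (integrableZl measurableT (q * h) ig)).
- exact: Lfun_integrable.
- by move=> x _; exact: gle.
Qed.

End bracket.

(** * Resolvents and the semigroup *)

Lemma J0_powR (R : realType) (p : R) : 1 <= p -> J0 (fun x => (`|x| `^ p)%:E).
Proof.
move=> p1; have p0 : 0 < p by exact: lt_le_trans p1.
split.
- by move=> x; rewrite lee_fin powR_ge0.
- by rewrite normr0 powR0// gt_eqF.
- move=> a x y a01; rewrite -!EFinM -EFinD lee_fin.
  apply: le_trans (powR_convex p1 a01 (normr_ge0 x) (normr_ge0 y)).
  apply: ler_powR2; rewrite ?(ltW p0)//.
  apply: le_trans (ler_normD _ _) _; case/andP: a01 => a0 a1.
  by rewrite !normrM (ger0_norm a0) (@ger0_norm _ (1 - a)) ?subr_ge0.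
- move=> x a; rewrite lte_fin => ax.
  exists [set y | a < `|y| `^ p] => [|y]; last by rewrite lte_fin.
  exact: (cvgr_gt _ (@continuous_norm_powR _ p p0 x) _ ax).
Qed.

(** The convex indicator of [-M, M]: its integral along a function vanishes exactly when the
    function is bounded by M a.e., so this choice of j turns complete accretivity into an L^oo
    estimate. *)
Lemma J0_ball (R : realType) (M : R) : 0 <= M ->
  J0 (fun x => if `|x| <= M then 0%E else +oo%E).
Proof.
move=> M0; split.
- by move=> x; case: ifP.
- by rewrite normr0 M0.
- move=> a x y /andP[a0 a1].
  have b0 : 0 <= 1 - a by rewrite subr_ge0.
  (* At the endpoints the convention 0 * +oo = 0 discards a possibly infinite value, so a = 0 and a
     = 1 are treated apart. *)
  have [->|an0] := eqVneq a 0.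
    by rewrite mul0r add0r subr0 mul1r !mul0e mul1e add0e.
  have [->|an1] := eqVneq a 1.
    by rewrite subrr !mul0r addr0 mul1r !mul0e mul1e adde0.
  have ap : 0 < a by rewrite lt_def an0.
  have bp : 0 < 1 - a by rewrite lt_def b0 subr_eq0 eq_sym an1.
  case: (leP `|x| M) => xM; last first.
    rewrite gt0_muley ?lte_fin// addye ?leey//.
    by case: ifP; rewrite ?mule0// gt0_muley ?lte_fin.
  case: (leP `|y| M) => yM; last by rewrite mule0 add0e gt0_muley ?lte_fin// leey.
  rewrite ifT ?mule0 ?adde0//.
  apply: le_trans (ler_normD _ _) _.
  by rewrite !normrM (ger0_norm a0) (ger0_norm b0); nra.
- move=> x a; case: (leP `|x| M) => [xM|Mx _].
    rewrite lte_fin => a0; exists setT; first exact: filterT.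
    by move=> y _; case: ifP; rewrite ?ltry ?lte_fin.
  exists [set y : R | M < `|y|].
    exact: (cvgr_gt _ (@norm_continuous _ _ x) _ Mx).
  by move=> y /= My; rewrite leNgt My ltry.
Qed.

Section resolvents.
Context {d : measure_display} {T : measurableType d} {R : realType}.
Variable mu : {measure set T -> \bar R}.
Variables (omega : R) (A : set ((T -> R) * (T -> R))).
Hypothesis caA : completely_accretive mu (addI omega A).

(** Dividing f = u + h v by 1 - h omega gives u + h/(1 - h omega) (v + omega u). The rescaled datum
    is the origin of the Lipschitz constant 1/(1 - h omega) of the resolvents of [A]. *)
Lemma resolvent_addI (h : R) (f u : T -> R) : h * omega < 1 ->
  resolvent h A (f, u) ->
  resolvent (h / (1 - h * omega)) (addI omega A) ((1 - h * omega)^-1 *: f, u).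
Proof.
move=> ho [[z v] Azv [<- <-]] /=.
have k0 : 1 - h * omega != 0 by rewrite subr_eq0 gt_eqF.
exists (z, v + omega *: z); first by exists (z, v).
congr pair; apply/funext => x /=.
by rewrite /= !fctE /GRing.scale/=; field.
Qed.

Lemma resolvent_contraction (p : \bar R) (h c : R) (f u f' u' : T -> R) :
  0 < h -> h * omega < 1 -> (1 <= p)%E -> 0 <= c ->
  measurable_fun setT f -> measurable_fun setT u ->
  measurable_fun setT f' -> measurable_fun setT u' ->
  resolvent h A (f, u) -> resolvent h A (f', u') ->
  (Lpnorm mu p (f - f') <= c%:E)%E ->
  (Lpnorm mu p (u - u') <= ((1 - h * omega)^-1 * c)%:E)%E.
Proof.
move=> h0 ho p1 c0 mf mu_ mf' mu'_ fu fu'.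
set a := (1 - h * omega)^-1.
have a0 : 0 < a by rewrite invr_gt0 subr_gt0.
have ac0 : 0 <= a * c by rewrite mulr_ge0// ltW.
have l0 : 0 < h / (1 - h * omega) by rewrite divr_gt0// subr_gt0.
have [_] := caA l0 (resolvent_addI ho fu) (resolvent_addI ho fu').
rewrite -/a => H.
have mff : measurable_fun setT (f - f') by exact: measurable_funB.
have muu : measurable_fun setT (u - u') by exact: measurable_funB.
have E x : (a *: f) x - (a *: f') x = a * (f x - f' x).
  by rewrite !fctE /GRing.scale/= mulrBr.
case: p p1 => [p||//] p1.
  have p0 : 0 < p by rewrite (lt_le_trans ltr01)// -lee_fin.
  rewrite !Lnorm_le_int// => fc.
  have := H _ (J0_powR p1); move=> /le_trans; apply.
  under eq_integral do rewrite E normrM (ger0_norm (ltW a0)) powRM ?(ltW a0)// EFinM.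
  rewrite ge0_integralZl//; last 2 first.
  - exact: (measurable_norm_powR p mff).
  - by rewrite lee_fin powR_ge0.
  by rewrite powRM ?(ltW a0)// EFinM lee_pmul2l// ?lte_fin ?powR_gt0.
move=> /(Lnormy_leP _ _ c0) fc; apply/Lnormy_leP => //.
pose j (x : R) := if `|x| <= a * c then 0%E else +oo%E : \bar R.
have ju : (\int[mu]_x j (u x - u' x)%R <=
    \int[mu]_x j ((a *: f) x - (a *: f') x)%R)%E := H _ (J0_ball ac0).
have mj : measurable_fun setT j.
  apply: lower_semicontinuous_measurable.
  by have [] := J0_ball ac0.
have mjg g : measurable_fun setT g -> measurable_fun setT (fun x : T => j (g x)).
  by move=> mg; exact: (measurableT_comp mj).
have j0 x : (0 <= j x)%E by rewrite /j; case: ifP.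
have : (\int[mu]_x j ((u - u') x)%R = 0)%E.
  apply/eqP; rewrite eq_le integral_ge0// andbT; apply: le_trans ju _.
  rewrite le_eqVlt; apply/orP; left; apply/eqP.
  rewrite (@ge0_ae_eq_integral _ _ _ _ _ _ (cst 0%E)) ?integral0//.
    apply: mjg; apply: measurable_funB; exact: measurable_funM.
  apply: filterS fc => x fc _; rewrite /j E normrM (ger0_norm (ltW a0)).
  by rewrite ler_pM2l// ifT.
have := @ae_eq_integral_abs _ _ _ mu setT measurableT _ (mjg _ muu).
under eq_integral do rewrite gee0_abs//.
move=> [+ _] => /[apply].
by apply: filterS => x /(_ I); rewrite /j; case: ifP.
Qed.

End resolvents.

Section iterates.
Context {d : measure_display} {T : measurableType d} {R : realType}.
Variable mu : {measure set T -> \bar R}.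
Variables (q omega : R) (A : set ((T -> R) * (T -> R))).
Hypothesis q_ge1 : 1 <= q.
Hypothesis opA : operator_on mu q A.
Hypothesis caA : completely_accretive mu (addI omega A).

Lemma resolvent_Lfun (h : R) (f u : T -> R) : resolvent h A (f, u) ->
  f \in Lfun mu q%:E /\ u \in Lfun mu q%:E.
Proof.
move=> [[z v] /opA.1[zq vq] [<- <-]] /=; split => //.
apply: LfunD; rewrite ?lee_fin//.
have -> : h *: v = h \o* v by apply/funext => x /=; rewrite /GRing.scale/= mulrC.
exact: Lfun_scale.
Qed.

Lemma resolvent_iter0 (h : R) (u w : T -> R) :
  resolvent_iter h A 0 (u, w) -> u = w.
Proof. by []. Qed.

Lemma resolvent_iter_Lfun (h : R) (n : nat) (u w : T -> R) :
  u \in Lfun mu q%:E -> resolvent_iter h A n (u, w) -> w \in Lfun mu q%:E.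
Proof.
elim: n u => [u uq /resolvent_iter0 <-//|n IH u uq [z /= uz]]; apply: IH.
by have [] := resolvent_Lfun uz.
Qed.

Lemma resolvent_iterD (h : R) (m n : nat) (u w : T -> R) :
  resolvent_iter h A (m + n) (u, w) ->
  exists2 z, resolvent_iter h A m (u, z) & resolvent_iter h A n (z, w).
Proof.
elim: m u => [u|m IH u [z uz /IH[z' zz' z'w]]]; first by exists u.
by exists z' => //; exists z.
Qed.

Lemma resolvent_iter_contraction (p : \bar R) (h c : R) (n : nat)
    (u u' w w' : T -> R) :
  0 < h -> h * omega < 1 -> (1 <= p)%E -> 0 <= c ->
  u \in Lfun mu q%:E -> u' \in Lfun mu q%:E ->
  resolvent_iter h A n (u, w) -> resolvent_iter h A n (u', w') ->
  (Lpnorm mu p (u - u') <= c%:E)%E ->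
  (Lpnorm mu p (w - w') <= ((1 - h * omega)^-1 ^+ n * c)%:E)%E.
Proof.
move=> h0 ho p1.
have a0 : 0 <= (1 - h * omega)^-1 by rewrite invr_ge0 subr_ge0 ltW.
elim: n u u' c => [u u' c c0 uq u'q /resolvent_iter0 <- /resolvent_iter0 <-|n
    IH u u' c c0 uq u'q].
  by rewrite expr0 mul1r.
move=> [z /= uz zw] [z' /= uz' zw'] uu'.
have [_ zq] := resolvent_Lfun uz; have [_ z'q] := resolvent_Lfun uz'.
rewrite exprSr -mulrA; apply: IH zw zw' _ => //; first by rewrite mulr_ge0.
apply: (resolvent_contraction caA h0 ho p1 c0 _ _ _ _ uz uz') => //;
  by apply: Lfun_measurable; eassumption.
Qed.

Lemma resolvent_iter_fixed (u0 : T -> R) (h : R) (n : nat) :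
  A (u0, cst 0) -> resolvent_iter h A n (u0, u0).
Proof.
move=> Au0; elim: n => [//|n IH]; exists u0 => //=.
by exists (u0, cst 0) => //=; rewrite scaler0 addr0.
Qed.

End iterates.

(** * Lipschitz estimates and the semigroup law from the Euler scheme *)

Section semigroup.
Context {d : measure_display} {T : measurableType d} {R : realType}.
Variable mu : {measure set T -> \bar R}.
Variables (q omega : R) (A : set ((T -> R) * (T -> R))).
Variables (S : R -> (T -> R) -> (T -> R)) (u0 : T -> R).
Hypothesis q_ge1 : 1 <= q.
Hypothesis omega_ge0 : 0 <= omega.
Hypothesis opA : operator_on mu q A.
Hypothesis caA : completely_accretive mu (addI omega A).
Hypothesis domA : densely_defined mu q A.
Hypothesis genS : semigroup_generated_by mu q A S.
Hypothesis Au0 : A (u0, cst 0).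

Local Notation Lq := (Lfun mu q%:E).

Lemma semigroup_Lfun (t : R) (u : T -> R) : 0 < t -> u \in Lq -> S t u \in Lq.
Proof. by move=> t0 uq; have [_ /(_ t t0)[]] := genS (domA uq). Qed.

(** With the limit z kept separate from [S], the constant scheme at [u0] is admissible as well, and
    S t u can be compared with [u0] without identifying S t u0. *)
Definition euler_limit (t : R) (u : T -> R) (w : nat -> T -> R) (z : T -> R) :=
  [/\ u \in Lq, z \in Lq,
      \forall n \near \oo, resolvent_iter (t / n%:R) A n (u, w n) &
      forall e, 0 < e ->
        \forall n \near \oo, (Lpnorm mu q%:E (w n - z) <= e%:E)%E].

Lemma semigroup_euler_limit (t : R) (u : T -> R) : 0 < t -> u \in Lq ->
  exists w, euler_limit t u w (S t u).
Proof.
move=> t0 uq; have [_ /(_ t t0)[zq [w wE wcvg]]] := genS (domA uq).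
exists w; split => //.
exact: ((ecvg0P (fun n => Lnorm_ge0 _ _ _)).1 wcvg).
Qed.

Lemma euler_limit_fixed (t : R) : euler_limit t u0 (fun=> u0) u0.
Proof.
have u0q : u0 \in Lq by have [] := opA.1 _ _ Au0.
split => //; first by apply: nearW => n; exact: resolvent_iter_fixed.
move=> e e0; apply: nearW => n; rewrite subrr (_ : _ \o _ = cst 0%E)//.
by rewrite Lnorm0 ?lee_fin ?ltW// gt_eqF// lte_fin (lt_le_trans ltr01).
Qed.

Lemma euler_limit_contraction (p : \bar R) (t c : R) u u' w w' z z' :
  0 < t -> (1 <= p)%E -> 0 <= c ->
  euler_limit t u w z -> euler_limit t u' w' z' ->
  (Lpnorm mu p (u - u') <= c%:E)%E ->
  (Lpnorm mu p (z - z') <= (expR (omega * t) * c)%:E)%E.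
Proof.
move=> t0 p1 c0 [uq zq wE wz] [u'q z'q wE' wz'] uu'.
have mw : \forall n \near \oo, measurable_fun setT (w n) /\ measurable_fun setT (w' n).
  apply: filterS2 wE wE' => n En En'; split; apply: Lfun_measurable.
    exact: (resolvent_iter_Lfun q_ge1 opA uq En).
  exact: (resolvent_iter_Lfun q_ge1 opA u'q En').
apply: le_expRD => e e0.
have ot0 : 0 <= omega * t by rewrite mulr_ge0// ltW.
apply: (@Lnorm_lsc _ _ _ mu q _ p (fun n => w n - w' n)) => //.
- by rewrite mulr_ge0// expR_ge0.
- by apply: measurable_funB; apply: Lfun_measurable; eassumption.
- have ote : omega * t < omega * t + e by rewrite ltrDl.
  near=> n.
  have [mwn mw'n] : measurable_fun setT (w n) /\ measurable_fun setT (w' n).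
    by near: n; exact: mw.
  split; first exact: measurable_funB.
  have n0 : 0 < n%:R :> R by near: n; exact: nbhs_infty_gtr.
  have [tn1 tne] : omega * t / n%:R < 1 /\
      ((1 - omega * t / n%:R)^-1) ^+ n <= expR (omega * t + e).
    by near: n; exact: euler_pow_le.
  have toE : omega * t / n%:R = t / n%:R * omega by ring.
  have En : resolvent_iter (t / n%:R) A n (u, w n) by near: n.
  have En' : resolvent_iter (t / n%:R) A n (u', w' n) by near: n.
  rewrite toE in tn1 tne.
  apply: le_trans (resolvent_iter_contraction q_ge1 opA caA _ tn1 p1 c0 uq u'q
      En En' uu') _.
    by rewrite divr_gt0.
  by rewrite lee_fin ler_wpM2r.
- move=> e' e'0; have e'2 : 0 < e' / 2 by rewrite divr_gt0.
  near=> n.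
  have [mwn mw'n] : measurable_fun setT (w n) /\ measurable_fun setT (w' n).
    by near: n; exact: mw.
  rewrite [e']splitr; apply: Lnorm_subr_subr => //; rewrite ?lee_fin//;
    try by apply: Lfun_measurable; eassumption.
    by near: n; exact: wz.
  by near: n; exact: wz'.
Unshelve. all: by end_near. Qed.

Lemma semigroup_contraction (p : \bar R) (t c : R) u u' :
  0 < t -> (1 <= p)%E -> 0 <= c -> u \in Lq -> u' \in Lq ->
  (Lpnorm mu p (u - u') <= c%:E)%E ->
  (Lpnorm mu p (S t u - S t u') <= (expR (omega * t) * c)%:E)%E.
Proof.
move=> t0 p1 c0 /(semigroup_euler_limit t0)[w uw] /(semigroup_euler_limit t0)[w' uw'].
exact: euler_limit_contraction uw uw'.
Qed.

Lemma semigroup_contraction_fixed (p : \bar R) (t c : R) u :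
  0 < t -> (1 <= p)%E -> 0 <= c -> u \in Lq ->
  (Lpnorm mu p (u - u0) <= c%:E)%E ->
  (Lpnorm mu p (S t u - u0) <= (expR (omega * t) * c)%:E)%E.
Proof.
move=> t0 p1 c0 /(semigroup_euler_limit t0)[w uw].
exact: euler_limit_contraction uw (euler_limit_fixed t).
Qed.

(* Euler steps for (j + 1) h and for h have the same size h / n when the former
   uses (j + 1) n steps, hence the semigroup law at commensurable times. *)
Lemma semigroup_natD (h : R) (j : nat) (u : T -> R) : 0 < h -> u \in Lq ->
  S (j.+2%:R * h) u = S h (S (j.+1%:R * h) u) %[ae mu].
Proof.
move=> h0 uq.
have t1 : 0 < j.+1%:R * h by rewrite mulr_gt0// ltr0n.
have t2 : 0 < j.+2%:R * h by rewrite mulr_gt0// ltr0n.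
have vq := semigroup_Lfun t1 uq.
have [w1 [_ _ w1E w1v]] := semigroup_euler_limit t1 uq.
have [w2 [_ zq w2E w2z]] := semigroup_euler_limit t2 uq.
have [w3 [_ z'q w3E w3z']] := semigroup_euler_limit h0 vq.
apply: (@Lfun_eq_ae _ _ _ mu q%:E) => // e e0.
have mul_near (k : nat) (P : nat -> Prop) : (\forall n \near \oo, P n) ->
    \forall n \near \oo, P (k.+1 * n)%N.
  by move=> [N _ NP]; exists N => // n /= Nn; apply: NP;
      rewrite /= (leq_trans Nn)// leq_pmull.
have stepE (k n : nat) : k.+1%:R * h / (k.+1 * n)%:R = h / n%:R.
  by rewrite natrM invfM mulrACA mulfV ?mul1r// pnatr_eq0.
(* [E] bounds the Lipschitz constant of the last n steps for large n, so the tolerance e / E at time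
   (j + 1) h becomes e at time (j + 2) h. *)
pose E := expR (omega * h + 1); have E0 : 0 < E by exact: expR_gt0.
have eE : 0 < e / E by rewrite divr_gt0.
have oh0 : 0 <= omega * h by rewrite mulr_ge0// ltW.
apply: (@Lnorm_lsc _ _ _ mu q _ q%:E (fun n => w2 (j.+2 * n)%N - w3 n)) => //.
- exact: ltW.
- by apply: measurable_funB; apply: Lfun_measurable; eassumption.
- near=> n.
  have n0 : 0 < n%:R :> R by near: n; exact: nbhs_infty_gtr.
  have E2 : resolvent_iter (h / n%:R) A (j.+2 * n) (u, w2 (j.+2 * n)%N).
    by rewrite -(stepE j.+1); near: n; exact: (mul_near j.+1 _ w2E).
  have E1 : resolvent_iter (h / n%:R) A (j.+1 * n) (u, w1 (j.+1 * n)%N).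
    by rewrite -(stepE j); near: n; exact: (mul_near j _ w1E).
  have E3 : resolvent_iter (h / n%:R) A n (S (j.+1%:R * h) u, w3 n) by near: n.
  have [hn1 hne] : omega * h / n%:R < 1 /\
      ((1 - omega * h / n%:R)^-1) ^+ n <= E.
    by near: n; apply: euler_pow_le => //; rewrite ltrDl.
  have ohE : omega * h / n%:R = h / n%:R * omega by ring.
  rewrite ohE in hn1 hne.
  have hn0 : 0 < h / n%:R by rewrite divr_gt0.
  have [z uz zw] : exists2 z, resolvent_iter (h / n%:R) A (j.+1 * n) (u, z) &
      resolvent_iter (h / n%:R) A n (z, w2 (j.+2 * n)%N).
    by apply: resolvent_iterD; rewrite addnC -mulSn.
  have zLq := resolvent_iter_Lfun q_ge1 opA uq uz.
  have w1q := resolvent_iter_Lfun q_ge1 opA uq E1.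
  have w2q := resolvent_iter_Lfun q_ge1 opA uq E2.
  have w3q := resolvent_iter_Lfun q_ge1 opA vq E3.
  split; first by apply: measurable_funB; apply: Lfun_measurable; eassumption.
  (* Both functions end the same number of equal Euler steps from u. Resolvents are single-valued
     only up to a.e. equality, so the Lipschitz estimate at distance 0 identifies them. *)
  have zw1 : (Lpnorm mu q%:E (z - w1 (j.+1 * n)%N) <= 0%:E)%E.
    rewrite -(mulr0 ((1 - h / n%:R * omega)^-1 ^+ (j.+1 * n))).
    apply: (resolvent_iter_contraction q_ge1 opA caA hn0 hn1 _ _ uq uq uz E1) => //.
    rewrite subrr (_ : _ \o _ = cst 0%E)//.
    by rewrite Lnorm0// gt_eqF// lte_fin (lt_le_trans ltr01).
  have w1v' : (Lpnorm mu q%:E (w1 (j.+1 * n)%N - S (j.+1%:R * h) u) <= (e / E)%:E)%E.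
    by near: n; exact: (mul_near j _ (w1v _ eE)).
  have zv : (Lpnorm mu q%:E (z - S (j.+1%:R * h) u) <= (e / E)%:E)%E.
    rewrite -[e / E]add0r.
    have -> : z - S (j.+1%:R * h) u =
      (z - w1 (j.+1 * n)%N) + (w1 (j.+1 * n)%N - S (j.+1%:R * h) u).
      by rewrite addrA subrK.
    apply: Lnorm_triangle => //;
      by apply: measurable_funB; apply: Lfun_measurable; eassumption.
  apply: le_trans (resolvent_iter_contraction q_ge1 opA caA hn0 hn1 _ _ zLq vq
      zw E3 zv) _ => //.
    exact: ltW.
  rewrite lee_fin; apply: (@le_trans _ _ (E * (e / E))).
    by rewrite ler_wpM2r// ltW.
  by rewrite mulrC divfK// gt_eqF.
- move=> e' e'0; have e'2 : 0 < e' / 2 by rewrite divr_gt0.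
  near=> n.
  have E2 : resolvent_iter (j.+2%:R * h / (j.+2 * n)%:R) A (j.+2 * n) (u, w2
      (j.+2 * n)%N).
    by near: n; exact: (mul_near j.+1 _ w2E).
  have E3 : resolvent_iter (h / n%:R) A n (S (j.+1%:R * h) u, w3 n) by near: n.
  have w2q := resolvent_iter_Lfun q_ge1 opA uq E2.
  have w3q := resolvent_iter_Lfun q_ge1 opA vq E3.
  rewrite [e']splitr; apply: Lnorm_subr_subr => //;
    try by apply: Lfun_measurable; eassumption.
    by near: n; exact: (mul_near j.+1 _ (w2z _ e'2)).
  by near: n; exact: w3z'.
Unshelve. all: by end_near. Qed.

End semigroup.

(** * Energy estimate along the implicit Euler scheme *)

Section energy.
Context {d : measure_display} {T : measurableType d} {R : realType}.
Variable mu : {measure set T -> \bar R}.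
Variables (q omega : R) (A : set ((T -> R) * (T -> R))).
Variables (r : \bar R) (rho sigma C : R) (u0 : T -> R).
Hypothesis q_ge1 : 1 <= q.
Hypothesis omega_ge0 : 0 <= omega.
Hypothesis opA : operator_on mu q A.
Hypothesis caA : completely_accretive mu (addI omega A).
Hypothesis r_ge1 : (1 <= r)%E.
Hypothesis rho_ge0 : 0 <= rho.
Hypothesis sigma_gt0 : 0 < sigma.
Hypothesis C_gt0 : 0 < C.
Hypothesis Au0 : A (u0, cst 0).
Hypothesis GN : forall u v : T -> R, A (u, v) ->
  (Lpnorm mu r (u - u0) `^ sigma <=
     C%:E * ((bracket mu q (u - u0) v)%:E +
             omega%:E * Lpnorm mu q%:E (u - u0) `^ q) *
     Lpnorm mu q%:E (u - u0) `^ rho)%E.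

Local Notation Lq := (Lfun mu q%:E).
Local Notation nrm u := (fine (Lpnorm mu q%:E (u - u0))).

Let u0q : u0 \in Lq. Proof. by have [] := opA.1 _ _ Au0. Qed.

Let subu0 (u : T -> R) : u \in Lq -> u - u0 \in Lq.
Proof. by move=> uq; apply: LfunB; rewrite ?lee_fin. Qed.

(** Here X is the dissipation, the bracket plus omega |u - u0|_q^q as in the hypothesis [GN];
    completing the bracket to X is what creates the factor 1 - q h omega. *)
Lemma resolvent_energy (h : R) (f u : T -> R) : 0 < h -> h * omega < 1 ->
  resolvent h A (f, u) ->
  exists X N, [/\ (1 - q * h * omega) * nrm u `^ q + q * h * X <= nrm f `^ q,
    0 <= N, (Lpnorm mu r (u - u0) <= N%:E)%E,
    N `^ sigma <= C * X * nrm u `^ rho &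
    (1 - h * omega) * nrm u <= nrm f].
Proof.
move=> h0 ho fu; have [fq uq] := resolvent_Lfun q_ge1 opA fu.
have k0 : 0 < 1 - h * omega by rewrite subr_gt0.
case: (fu) => [[z v] Azv [ef eu]]; rewrite /= in ef eu.
rewrite {z}eu in Azv ef.
have [_ vq] := opA.1 _ _ Azv.
pose X := bracket mu q (u - u0) v + omega * nrm u `^ q.
have gn : (Lpnorm mu r (u - u0) `^ sigma <= (C * X * nrm u `^ rho)%:E)%E.
  by have := GN Azv; rewrite -[in leRHS](Lfun_norm_fineK (subu0 uq)).
(* The right-hand side of [gn] is a real number, so the inequality itself puts u - u0 into L^r. *)
have Nfin : (Lpnorm mu r (u - u0) < +oo)%E.
  by apply: (@lty_poweRy _ _ sigma); rewrite ?gt_eqF// (le_lt_trans gn)// ltry.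
have NE : ((fine (Lpnorm mu r (u - u0)))%:E = Lpnorm mu r (u - u0))%E.
  by rewrite fineK// ge0_fin_numE// Lnorm_ge0.
exists X, (fine (Lpnorm mu r (u - u0))); split.
- have -> : (1 - q * h * omega) * nrm u `^ q + q * h * X =
      nrm u `^ q + q * h * bracket mu q (u - u0) v by rewrite /X; ring.
  have fE : f - u0 = (u - u0) + h *: v by rewrite -ef addrAC.
  rewrite fE; apply: bracket_le => //; first exact: subu0.
  by rewrite -fE; exact: subu0.
- exact: fine_Lnorm_ge0.
- by rewrite NE.
- by rewrite -lee_fin -poweR_EFin NE.
- have u0u0 : resolvent h A (u0, u0).
    by exists (u0, cst 0) => //=; rewrite scaler0 addr0.
  have fle : (Lpnorm mu q%:E (f - u0) <= (nrm f)%:E)%E.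
    by rewrite Lfun_norm_fineK//; exact: subu0.
  have := @resolvent_contraction _ _ _ mu omega A caA q%:E h (nrm f) f u u0 u0 h0 ho.
  rewrite lee_fin => /(_ q_ge1 (fine_Lnorm_ge0 _ _ _)).
  move=> /(_ (Lfun_measurable fq) (Lfun_measurable uq)
    (Lfun_measurable u0q) (Lfun_measurable u0q) fu u0u0 fle).
  rewrite -(Lfun_norm_fineK (subu0 uq)) lee_fin.
  by rewrite -(ler_pM2l k0) mulrA mulfV ?gt_eqF// mul1r.
Qed.

(** The dissipation is bounded below by N^sigma only after multiplication by |u - u0|_q^rho. The
    energy inequality is multiplied by this power, and on the right u is replaced by f through the
    L^q Lipschitz estimate, at the cost of the factor (1 - h omega)^rho. *)
Lemma resolvent_energy_step (h : R) (f u : T -> R) :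
  0 < h -> h * omega < 1 -> q * h * omega < 1 -> resolvent h A (f, u) ->
  exists N, [/\ 0 <= N, (Lpnorm mu r (u - u0) <= N%:E)%E &
    (1 - h * omega) `^ rho * ((1 - q * h * omega) * nrm u `^ (q + rho) +
      q * h / C * N `^ sigma) <= nrm f `^ (q + rho)].
Proof.
move=> h0 ho qho fu; have [X [N [en N0 rN gn nz]]] := resolvent_energy h0 ho fu.
exists N; split => //; set k := 1 - h * omega.
have q0 : 0 < q by exact: lt_le_trans q_ge1.
have k0 : 0 < k by rewrite subr_gt0.
have krho : 0 < k `^ rho by rewrite powR_gt0.
have nn0 (v : T -> R) : 0 <= nrm v by exact: fine_Lnorm_ge0.
have pE (v : T -> R) : nrm v `^ (q + rho) = nrm v `^ q * nrm v `^ rho.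
  by rewrite powRD// gt_eqF// ltr_pwDl.
rewrite !pE.
have H1 : k `^ rho * nrm u `^ rho <= nrm f `^ rho.
  by rewrite -powRM ?(ltW k0)// ler_powR2// mulr_ge0// ltW.
apply: (@le_trans _ _ (nrm f `^ q * (k `^ rho * nrm u `^ rho))); last first.
  by rewrite ler_wpM2l// powR_ge0.
have zr : 0 <= k `^ rho * nrm u `^ rho by rewrite mulr_ge0 ?powR_ge0.
have := ler_wpM2r zr en; apply: le_trans.
have H2 : q * h / C * N `^ sigma <= q * h * X * nrm u `^ rho.
  have -> : q * h * X * nrm u `^ rho = q * h / C * (C * X * nrm u `^ rho).
    by field; exact: lt0r_neq0.
  by rewrite ler_pM2l// divr_gt0// mulr_gt0.
by have := ler_wpM2l (ltW krho) H2; lra.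
Qed.

(* Each Euler step loses at most the factor b in nrm ^ (q + rho), and gains the
   term in N ^ sigma: this is the discrete form of integrating the derivative of
   expR (- q omega t) * |u(t) - u0|_q ^ q. *)
Lemma resolvent_iter_energy (h : R) (n : nat) (u w : T -> R) :
  0 < h -> h * omega < 1 -> q * h * omega < 1 -> u \in Lq ->
  resolvent_iter h A n.+1 (u, w) ->
  let b := (1 - h * omega) `^ (rho + sigma) * (1 - q * h * omega) in
  exists N, [/\ 0 <= N, (Lpnorm mu r (w - u0) <= N%:E)%E &
    b ^+ n.+1 * n.+1%:R * (q * h / C) * N `^ sigma <= nrm u `^ (q + rho)].
Proof.
move=> h0 ho qho + + b; set k := 1 - h * omega.
have q0 : 0 < q by exact: lt_le_trans q_ge1.
have ho0 : 0 <= h * omega by rewrite mulr_ge0// ltW.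
have k0 : 0 < k by rewrite subr_gt0.
have k1 : k <= 1 by rewrite gerBl.
have l0 : 0 < 1 - q * h * omega by rewrite subr_gt0.
have l1 : 1 - q * h * omega <= 1 by rewrite gerBl -mulrA mulr_ge0// ltW.
have powk1 s : 0 <= s -> k `^ s <= 1.
  by move=> s0; rewrite -(powRr0 k); apply: ger_powR => //; rewrite k0.
have krho : 0 < k `^ rho by rewrite powR_gt0.
have ksig : 0 < k `^ sigma by rewrite powR_gt0.
(* The first and last factors are the losses of one energy step; k^sigma pays for carrying a bound
   in L^r over one more step. *)
have bE : b = k `^ rho * k `^ sigma * (1 - q * h * omega).
  by rewrite /b powRD// (gt_eqF k0) implybT.
have b0 : 0 < b by rewrite bE !mulr_gt0.
have b_le1 : b <= k `^ rho * (1 - q * h * omega).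
  by rewrite bE mulrAC ler_piMr ?powk1// ?(ltW sigma_gt0)// mulr_ge0// ltW.
have b_le2 : b <= k `^ rho.
  by apply: le_trans b_le1 _; rewrite ler_piMr// ltW.
have b_le3 : b <= k `^ sigma.
  rewrite bE -mulrA mulrCA ler_piMr ?(ltW ksig)//.
  by rewrite mulr_ile1 ?powk1// ltW.
have c0 : 0 < q * h / C by rewrite divr_gt0// mulr_gt0.
elim: n u => [|n IH] u uq [z /= uz zw]; have [_ zq] := resolvent_Lfun q_ge1 opA uz;
  have [N [N0 rN step]] := resolvent_energy_step h0 ho qho uz.
  have <- := @resolvent_iter0 _ _ _ A h _ _ zw; exists N; split=> //.
  apply: le_trans step; rewrite expr1 mulr1 -mulrA.
  have F0 : 0 <= (1 - q * h * omega) * nrm z `^ (q + rho).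
    by rewrite mulr_ge0 ?powR_ge0// ltW.
  have G0 : 0 <= q * h / C * N `^ sigma by rewrite mulr_ge0 ?powR_ge0// ltW.
  apply: (@le_trans _ _ (k `^ rho * (q * h / C * N `^ sigma))).
    by rewrite ler_wpM2r.
  by rewrite ler_pM2l// lerDr.
have [N' [N'0 rN' IHz]] := IH z zq zw.
(* The bound N holds after the first step; the remaining n + 1 steps transport it to w by the L^r
   Lipschitz estimate. *)
have Naw : (Lpnorm mu r (w - u0) <= (k^-1 ^+ n.+1 * N)%:E)%E.
  have En := resolvent_iter_fixed h n.+1 Au0.
  exact: (@resolvent_iter_contraction _ _ _ _ _ _ _ q_ge1 opA caA r h N n.+1
    z u0 w u0 h0 ho r_ge1 N0 zq u0q zw En rN).
have a0 : 0 <= k^-1 ^+ n.+1 by rewrite exprn_ge0// invr_ge0 ltW.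
(* As the smaller of the two bounds on w, [M] is admissible both in the n + 1 contributions
   collected by induction and in the contribution of the first step. *)
pose M := Num.min N' (k^-1 ^+ n.+1 * N).
have M0 : 0 <= M by rewrite le_min N'0 mulr_ge0.
exists M; split => //.
  by rewrite /M; case: (leP N' (k^-1 ^+ n.+1 * N)).
move: c0 IHz step; set c := q * h / C => c0 IHz step.
have MN' : M `^ sigma <= N' `^ sigma
    by rewrite ler_powR2 ?(ltW sigma_gt0)// ge_min lexx.
have MN : (k `^ sigma) ^+ n.+1 * M `^ sigma <= N `^ sigma.
  have -> : (k `^ sigma) ^+ n.+1 = (k ^+ n.+1) `^ sigma.
    by rewrite powR_expn// ltW.
  rewrite -powRM ?exprn_ge0 ?(ltW k0)// ler_powR2 ?(ltW sigma_gt0)//.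
    by rewrite mulr_ge0// exprn_ge0// ltW.
  apply: (@le_trans _ _ (k ^+ n.+1 * (k^-1 ^+ n.+1 * N))).
    by rewrite ler_pM2l ?exprn_gt0// ge_min lexx orbT.
  by rewrite mulrA -exprMn mulfV ?gt_eqF// expr1n mul1r.
have Ms0 : 0 <= c * M `^ sigma by rewrite mulr_ge0 ?powR_ge0// ltW.
have b0' := ltW b0.
have T1 : b ^+ n.+2 * n.+1%:R * c * M `^ sigma <=
    k `^ rho * ((1 - q * h * omega) * nrm z `^ (q + rho)).
  have -> : b ^+ n.+2 * n.+1%:R * c * M `^ sigma =
      b * (b ^+ n.+1 * n.+1%:R * c * M `^ sigma).
    by rewrite [b ^+ n.+2]exprS; ring.
  apply: (@le_trans _ _ (b * nrm z `^ (q + rho))).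
    rewrite ler_pM2l//; apply: le_trans IHz; rewrite ler_wpM2l//.
    by rewrite mulr_ge0 ?(ltW c0)// mulr_ge0// exprn_ge0.
  by rewrite [leRHS]mulrA ler_wpM2r// powR_ge0.
have T2 : b ^+ n.+2 * c * M `^ sigma <= k `^ rho * (c * N `^ sigma).
  have bM : b ^+ n.+1 * M `^ sigma <= N `^ sigma.
    apply: le_trans MN; rewrite ler_wpM2r ?powR_ge0//.
    by apply: lerXn2r; rewrite ?nnegrE ?(ltW ksig).
  have cbM : c * (b ^+ n.+1 * M `^ sigma) <= c * N `^ sigma by rewrite ler_pM2l.
  have -> : b ^+ n.+2 * c * M `^ sigma = b * (c * (b ^+ n.+1 * M `^ sigma)).
    by rewrite [b ^+ n.+2]exprS; ring.
  apply: ler_pM => //; rewrite mulr_ge0 ?(ltW c0)// mulr_ge0 ?powR_ge0//.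
  exact: exprn_ge0.
rewrite mulrDr in step; rewrite -[n.+2]addn1 natrD.
have -> : b ^+ (n.+1 + 1) * (n.+1%:R + 1%:R) * c * M `^ sigma =
  b ^+ n.+2 * n.+1%:R * c * M `^ sigma + b ^+ n.+2 * c * M `^ sigma.
  by rewrite addn1; ring.
by apply: le_trans step; exact: lerD.
Qed.

End energy.

(** * The smoothing estimate from L^q to L^r *)

Section smoothing.
Context {d : measure_display} {T : measurableType d} {R : realType}.
Variable mu : {measure set T -> \bar R}.
Variables (q omega : R) (A : set ((T -> R) * (T -> R))).
Variables (r : \bar R) (rho sigma C : R) (u0 : T -> R).
Variable S : R -> (T -> R) -> (T -> R).
Hypothesis q_ge1 : 1 <= q.
Hypothesis omega_ge0 : 0 <= omega.
Hypothesis opA : operator_on mu q A.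
Hypothesis domA : densely_defined mu q A.
Hypothesis caA : completely_accretive mu (addI omega A).
Hypothesis r_ge1 : (1 <= r)%E.
Hypothesis rho_ge0 : 0 <= rho.
Hypothesis sigma_gt0 : 0 < sigma.
Hypothesis C_gt0 : 0 < C.
Hypothesis Au0 : A (u0, cst 0).
Hypothesis GN : forall u v : T -> R, A (u, v) ->
  (Lpnorm mu r (u - u0) `^ sigma <=
     C%:E * ((bracket mu q (u - u0) v)%:E +
             omega%:E * Lpnorm mu q%:E (u - u0) `^ q) *
     Lpnorm mu q%:E (u - u0) `^ rho)%E.
Hypothesis genS : semigroup_generated_by mu q A S.

Local Notation Lq := (Lfun mu q%:E).
Local Notation nrm u := (fine (Lpnorm mu q%:E (u - u0))).

(** With n steps of size t / n the energy estimate reads N^sigma <= C/(q t) b^(-n) |u - u0|_q^(q +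
    rho). The limit of b^(-n) is the exponential of omega t (rho + sigma + q) = sigma (gamma + 1)
    omega t, which is the origin of beta = gamma + 1. *)
Lemma semigroup_smoothing (t : R) (u : T -> R) : 0 < t -> u \in Lq ->
  (Lpnorm mu r (S t u - u0) <=
     (expR (omega * ((q + rho) / sigma + 1) * t) *
     ((C / q) `^ (1 / sigma) * t `^ (- (1 / sigma)) *
      nrm u `^ ((q + rho) / sigma)))%:E)%E.
Proof.
move=> t0 uq; have q0 : 0 < q by exact: lt_le_trans q_ge1.
have sn0 : sigma != 0 by rewrite gt_eqF.
have u0q : u0 \in Lq by have [] := opA.1 _ _ Au0.
have [w [_ zq wE wz]] := semigroup_euler_limit domA genS t0 uq.
have nu0 : 0 <= nrm u by exact: fine_Lnorm_ge0.
apply: le_expRD => e e0; set c := _ `^ _ * _ * _; set a := omega * _ * t.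
have c0 : 0 <= c by rewrite !mulr_ge0 ?powR_ge0.
apply: (@Lnorm_lsc _ _ _ mu q _ r (fun n => w n - u0)) => //.
- by rewrite mulr_ge0// expR_ge0.
- by apply: measurable_funB; apply: Lfun_measurable; eassumption.
(* The margins satisfy (rho + sigma) e1 + e2 = sigma e, the total allowed in the exponent after
   raising to the power sigma. *)
- pose e1 := sigma * e / (2 * (rho + sigma)); pose e2 := sigma * e / 2.
  have rs0 : 0 < rho + sigma by rewrite ltr_wpDl.
  have e10 : 0 < e1 by rewrite divr_gt0// mulr_gt0.
  have e20 : 0 < e2 by rewrite divr_gt0// mulr_gt0.
  have ot0 : 0 <= omega * t by rewrite mulr_ge0// ltW.
  have qot0 : 0 <= q * omega * t by rewrite -mulrA mulr_ge0// ltW.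
  have key n w' : (0 < n)%N ->
      omega * t / n%:R < 1 /\
        ((1 - omega * t / n%:R)^-1) ^+ n <= expR (omega * t + e1) ->
      q * omega * t / n%:R < 1 /\
        ((1 - q * omega * t / n%:R)^-1) ^+ n <= expR (q * omega * t + e2) ->
      resolvent_iter (t / n%:R) A n (u, w') ->
      measurable_fun setT (w' - u0) /\
      (Lpnorm mu r (w' - u0) <= (expR (a + e) * c)%:E)%E.
    case: n => [//|n] _ [+ +] [+ +].
    have -> : omega * t / n.+1%:R = t / n.+1%:R * omega by ring.
    have -> : q * omega * t / n.+1%:R = q * (t / n.+1%:R) * omega by ring.
    set h := t / n.+1%:R => h1 h2 k1 k2 En.
    have wq := resolvent_iter_Lfun q_ge1 opA uq En.
    split; first by apply: measurable_funB; apply: Lfun_measurable; eassumption.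
    have h0 : 0 < h by rewrite divr_gt0// ltr0n.
    have [N [N0 wN NE]] := resolvent_iter_energy q_ge1 omega_ge0 opA caA r_ge1
      rho_ge0 sigma_gt0 C_gt0 Au0 GN h0 h1 k1 uq En.
    apply: le_trans wN _; rewrite lee_fin.
    have kp : 0 < 1 - h * omega by rewrite subr_gt0.
    have lp : 0 < 1 - q * h * omega by rewrite subr_gt0.
    move: NE h2 k2 => /=; set k := 1 - h * omega in kp *.
    set l := 1 - q * h * omega in lp *.
    set b := k `^ _ * l => NE h2 k2.
    have b0 : 0 < b by rewrite mulr_gt0// powR_gt0.
    apply: (@ler_powR2_inv _ sigma) => //; first by rewrite mulr_ge0// expR_ge0.
    have bn : b^-1 ^+ n.+1 <= expR ((a + e) * sigma).
      have -> : b^-1 ^+ n.+1 = (k^-1 ^+ n.+1) `^ (rho + sigma) * l^-1 ^+ n.+1.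
        rewrite /b invfM exprMn; congr (_ * _).
        have -> : (k `^ (rho + sigma))^-1 = k^-1 `^ (rho + sigma).
          by rewrite -(powR_inv1 (ltW kp)) -powRrM mulN1r powRN.
        by rewrite powR_expn// invr_ge0 ltW.
      have -> : (a + e) * sigma =
          (omega * t + e1) * (rho + sigma) + (q * omega * t + e2).
        by rewrite /a /e1 /e2; field; rewrite sn0 gt_eqF.
      rewrite expRD expRM; apply: ler_pM => //; rewrite ?powR_ge0//.
        by rewrite exprn_ge0// invr_ge0 ltW.
      by apply: ler_powR2; rewrite ?(ltW rs0)// exprn_ge0// invr_ge0 ltW.
    have cs : c `^ sigma = C / (q * t) * nrm u `^ (q + rho).
      have Cq0 : 0 <= C / q by rewrite divr_ge0// ltW.
      have E1 : ((C / q) `^ (1 / sigma)) `^ sigma = C / q.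
        by rewrite -powRrM divfK// powRr1.
      have E2 : (t `^ (- (1 / sigma))) `^ sigma = t^-1.
        by rewrite -powRrM mulNr divfK// powR_inv1// ltW.
      have E3 : (nrm u `^ ((q + rho) / sigma)) `^ sigma = nrm u `^ (q + rho).
        by rewrite -powRrM divfK.
      rewrite /c powRM ?powR_ge0//; last by rewrite mulr_ge0 ?powR_ge0.
      rewrite powRM ?powR_ge0// E1 E2 E3 invfM; ring.
    rewrite powRM ?expR_ge0// cs -expRM.
    have -> : N `^ sigma = b^-1 ^+ n.+1 * (C / (q * t)) *
        (b ^+ n.+1 * n.+1%:R * (q * h / C) * N `^ sigma).
      have alg (B m X : R) : B != 0 -> m != 0 ->
          X = B^-1 * (C / (q * t)) * (B * m * (q * (t / m) / C) * X).
        move=> B0 m0; field.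
        by rewrite B0 m0 (gt_eqF C_gt0) (gt_eqF t0) (gt_eqF q0).
      by rewrite exprVn; apply: alg; rewrite ?pnatr_eq0// expf_neq0// gt_eqF.
    have D0 : 0 <= C / (q * t) by rewrite divr_ge0 ?(ltW C_gt0)// ltW// mulr_gt0.
    have B0 : 0 <= b^-1 ^+ n.+1 by rewrite exprn_ge0// invr_ge0 ltW.
    have H0 : 0 <= q * h / C by rewrite divr_ge0 ?(ltW C_gt0)// ltW// mulr_gt0.
    rewrite [leRHS]mulrA; apply: ler_pM => //.
    + exact: mulr_ge0.
    + by rewrite mulr_ge0 ?powR_ge0// mulr_ge0// mulr_ge0// exprn_ge0// ltW.
    + by rewrite ler_wpM2r.
  near=> n; apply: (key n (w n)); first by near: n; exact: nbhs_infty_gt.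
  - by near: n; apply: euler_pow_le => //; rewrite ltrDl.
  - by near: n; apply: euler_pow_le => //; rewrite ltrDl.
  - by near: n.
- move=> e' e'0; apply: filterS (wz _ e'0) => n.
  by have -> : (w n - u0) - (S t u - u0) = w n - S t u by rewrite opprB addrA subrK.
Unshelve. all: by end_near. Qed.

End smoothing.

(** * Smoothing into L^oo *)

Definition clip {R : realType} (lam x : R) : R := Num.max (- lam) (Num.min lam x).

Lemma norm_clip_le (R : realType) (lam x : R) : 0 <= lam -> `|clip lam x| <= lam.
Proof.
move=> l0; rewrite ler_norml /clip; have l2 : - lam <= lam by lra.
by rewrite le_max lexx/= ge_max l2/= ge_min lexx.
Qed.

Lemma norm_sub_clip (R : realType) (lam x : R) : 0 <= lam ->
  `|x - clip lam x| = Num.max (`|x| - lam) 0.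
Proof.
move=> l0; rewrite /clip; case: (leP lam x) => xl.
  rewrite (max_idPr _); last by lra.
  have x0 : 0 <= x by exact: le_trans xl.
  by rewrite (ger0_norm x0) ger0_norm ?subr_ge0// (max_idPl _)// subr_ge0.
case: (leP (- lam) x) => xl'.
  rewrite subrr normr0 (max_idPr _)// subr_le0 ler_norml xl'//.
  exact: ltW.
have x0 : x < 0 by apply: lt_le_trans xl' _; rewrite oppr_le0.
rewrite (ltr0_norm x0) ltr0_norm; last by lra.
by rewrite (max_idPl _); lra.
Qed.

Section truncation.
Context {d : measure_display} {T : measurableType d} {R : realType}.
Variable mu : {measure set T -> \bar R}.

Lemma measurable_clip (lam : R) (f : T -> R) : measurable_fun setT f ->
  measurable_fun setT (clip lam \o f).
Proof.
move=> mf; apply: measurable_maxr => //.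
by apply: measurable_minr.
Qed.

Lemma measurable_trunc (lam p : R) (f : T -> R) : measurable_fun setT f ->
  measurable_fun setT (fun x => (Num.max (`|f x| - lam) 0 `^ p)%:E).
Proof.
move=> mf; apply/measurable_EFinP.
apply: (measurableT_comp (measurable_powR p)).
apply: measurable_maxr => //; apply: measurable_funB => //.
exact: measurableT_comp.
Qed.

Variables (q r omega M al gamma : R) (u0 : T -> R).
Variable S : R -> (T -> R) -> (T -> R).
Hypothesis q_ge1 : 1 <= q.
Hypothesis r_ge1 : 1 <= r.
Hypothesis omega_ge0 : 0 <= omega.
Hypothesis gamma_gt0 : 0 < gamma.
Hypothesis M_gt0 : 0 < M.
Let M_ge0 := ltW M_gt0.
Hypothesis u0q : u0 \in Lfun mu q%:E.
Local Notation Lq := (Lfun mu q%:E).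
Hypothesis S_Lfun : forall t u, 0 < t -> u \in Lq -> S t u \in Lq.
Hypothesis S_contraction : forall t c u u', 0 < t -> 0 <= c ->
  u \in Lq -> u' \in Lq -> (Lpnorm mu +oo (u - u') <= c%:E)%E ->
  (Lpnorm mu +oo (S t u - S t u') <= (expR (omega * t) * c)%:E)%E.
Hypothesis S_smoothing : forall t u, 0 < t -> omega * t <= 1 -> u \in Lq ->
  (Lpnorm mu r%:E (S t u - u0) <=
    (M * t `^ (- al) * fine (Lpnorm mu q%:E (u - u0)) `^ gamma)%:E)%E.

(* Compare u with v = u0 + (w - clip lam w), where w = u - u0: the L^oo
   Lipschitz bound gives |S h u - S h v| <= expR (omega * h) * lam. *)
Lemma truncated_smoothing (h lam Y : R) (u : T -> R) :
  0 < h -> omega * h <= 1 -> u \in Lq -> 0 <= lam -> 0 <= Y ->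
  (\int[mu]_x (Num.max (`|u x - u0 x| - lam) 0 `^ q)%:E <= Y%:E)%E ->
  (\int[mu]_x
     (Num.max (`|S h u x - u0 x| - expR (omega * h) * lam) 0 `^ r)%:E <=
   (M `^ r * h `^ (- (al * r)) * Y `^ (gamma * r / q))%:E)%E.
Proof.
move=> h0 oh uq l0 Y0 uY.
have q0 : 0 < q by exact: lt_le_trans q_ge1.
have r0 : 0 < r by exact: lt_le_trans r_ge1.
have mu0 := Lfun_measurable u0q; have mu_ := Lfun_measurable uq.
pose w := u - u0; have mw : measurable_fun setT w by exact: measurable_funB.
pose g := w - (clip lam \o w).
have mg : measurable_fun setT g.
  by apply: measurable_funB => //; exact: measurable_clip.
have gE x : `|g x| = Num.max (`|u x - u0 x| - lam) 0 by exact: norm_sub_clip.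
have gq : g \in Lq.
  apply: LfunI => //; rewrite Lnorm_lty_int//.
  under eq_integral do rewrite gE.
  by apply: le_lt_trans uY _; rewrite ltry.
pose v := u0 + g.
have vq : v \in Lq by apply: LfunD; rewrite ?lee_fin.
have vE : v - u0 = g by rewrite /v addrAC subrr add0r.
have gY : fine (Lpnorm mu q%:E (v - u0)) <= Y `^ q^-1.
  rewrite vE -lee_fin Lfun_norm_fineK// Lnorm_le_int ?powR_ge0//.
  under eq_integral do rewrite gE.
  by rewrite -powRrM mulVf ?gt_eqF// powRr1.
have Sv : (Lpnorm mu r%:E (S h v - u0) <=
    (M * h `^ (- al) * (Y `^ q^-1) `^ gamma)%:E)%E.
  apply: le_trans (S_smoothing h0 oh vq) _.
  rewrite lee_fin ler_wpM2l ?mulr_ge0 ?powR_ge0//.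
  by apply: ler_powR2 => //; [exact: ltW|exact: fine_Lnorm_ge0].
have Svu : \forall x \ae mu, `|(S h u - S h v) x| <= expR (omega * h) * lam.
  apply/Lnormy_leP; first by rewrite mulr_ge0// expR_ge0.
  apply: S_contraction => //; apply/Lnormy_leP => //; apply: nearW => x.
  have -> : (u - v) x = clip lam (w x).
    by rewrite /v /g /w !fctE /=; ring.
  exact: norm_clip_le.
move: Sv; rewrite Lnorm_le_int//; last by rewrite !mulr_ge0 ?powR_ge0.
have -> : (M * h `^ (- al) * (Y `^ q^-1) `^ gamma) `^ r =
    M `^ r * h `^ (- (al * r)) * Y `^ (gamma * r / q).
  rewrite !powRM ?mulr_ge0 ?powR_ge0//; congr (_ * _ * _).
    by rewrite -powRrM mulNr.
  by rewrite -!powRrM; congr (_ `^ _); ring.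
apply: le_trans.
have mSu := Lfun_measurable (S_Lfun h0 uq).
have mSv := Lfun_measurable (S_Lfun h0 vq).
apply: ae_ge0_le_integral => //.
- by move=> x _; rewrite lee_fin powR_ge0.
- exact: (measurable_trunc _ r (measurable_funB mSu mu0)).
- exact: (measurable_norm_powR r (measurable_funB mSv mu0)).
apply: filterS Svu => x Sx _; rewrite lee_fin; apply: ler_powR2; first exact: ltW.
  by rewrite le_max lexx orbT.
rewrite ge_max normr_ge0 andbT.
have := ler_normD (S h u x - S h v x) (S h v x - u0 x).
rewrite addrA subrK => H; rewrite lerBlDr; apply: le_trans H _.
by rewrite addrC lerD2l.
Qed.

(** Where |f| exceeds the upper level e^y l, its excess over the lower level e^y l' lies between eta
    e^y N and e^y N, so [powR_change_exp] applies; elsewhere the left integrand is 0. The bound y <=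
    1 turns the power of e^y into a constant. *)
Lemma truncated_change_exp (y N eta l l' p p' Z : R) (f : T -> R) :
  measurable_fun setT f -> 0 <= y <= 1 -> 0 < N -> 0 < eta -> 0 <= l' ->
  l - l' = eta * N -> 0 < p -> 0 <= Z ->
  (\forall x \ae mu, `|f x| <= expR y * N) ->
  (\int[mu]_x (Num.max (`|f x| - expR y * l') 0 `^ p')%:E <= Z%:E)%E ->
  (\int[mu]_x (Num.max (`|f x| - expR y * l) 0 `^ p)%:E <=
   (expR `|p - p'| * N `^ (p - p') * eta `^ (- `|p - p'|) * Z)%:E)%E.
Proof.
move=> mf /andP[y0 y1] N0 eta0 l'0 ll' p0 Z0 fN fZ.
set c := _ * _ * _ `^ _; have c0 : 0 <= c by rewrite !mulr_ge0 ?powR_ge0 ?expR_ge0.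
have E0 := expR_gt0 y.
apply: (@le_trans _ _ (\int[mu]_x (c%:E * (Num.max (`|f x| - expR y * l') 0 `^
    p')%:E))%E).
  apply: ae_ge0_le_integral => //.
  - by move=> x _; rewrite lee_fin powR_ge0.
  - exact: measurable_trunc.
  - by move=> x _; rewrite -EFinM lee_fin mulr_ge0// powR_ge0.
  - by apply: emeasurable_funM => //; exact: measurable_trunc.
  apply: filterS fN => x fN _; rewrite -EFinM lee_fin.
  have [fl|lf] := leP `|f x| (expR y * l).
    by rewrite (max_idPr _) ?subr_le0// powR0 ?gt_eqF// mulr_ge0 ?powR_ge0.
  have El : expR y * l = expR y * l' + eta * (expR y * N).
    by rewrite mulrCA -ll'; ring.
  have EN0 : 0 < expR y * N by rewrite mulr_gt0.
  have etaEN : 0 < eta * (expR y * N) by rewrite mulr_gt0.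
  have El'0 : 0 <= expR y * l' by rewrite mulr_ge0// ltW.
  rewrite (max_idPl _); last by rewrite subr_ge0 ltW.
  rewrite (max_idPl _); last by rewrite El in lf; lra.
  apply: (@le_trans _ _ ((`|f x| - expR y * l') `^ p)).
    by apply: ler_powR2; rewrite ?(ltW p0)//; rewrite El in lf *; lra.
  apply: le_trans (@powR_change_exp _ p p' _ (expR y * N) eta EN0 eta0 _) _.
    by rewrite El in lf; apply/andP; split; lra.
  rewrite ler_wpM2r ?powR_ge0// ler_wpM2r ?powR_ge0// powRM ?(ltW E0) ?(ltW N0)//.
  rewrite ler_wpM2r ?powR_ge0// -expRM ler_expR.
  have := ler_norm (y * (p - p')); rewrite normrM (ger0_norm y0) => /le_trans; apply.
  by rewrite ler_piMl.
rewrite ge0_integralZl_EFin//; last 2 first.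
- by move=> x _; rewrite lee_fin powR_ge0.
- exact: measurable_trunc.
by rewrite [leRHS]EFinM; apply: lee_wpmul2l => //; rewrite lee_fin.
Qed.

Hypothesis S_fixed : forall p t c u, (1 <= p)%E -> 0 < t -> 0 <= c ->
  u \in Lq -> (Lpnorm mu p (u - u0) <= c%:E)%E ->
  (Lpnorm mu p (S t u - u0) <= (expR (omega * t) * c)%:E)%E.
Hypothesis S_natD : forall h j u, 0 < h -> u \in Lq ->
  S (j.+2%:R * h) u = S h (S (j.+1%:R * h) u) %[ae mu].

Lemma semigroup_step (t h : R) (j : nat) (u : T -> R) :
  t = j.+1%:R * h -> 0 < h -> u \in Lq -> S (t + h) u = S h (S t u) %[ae mu].
Proof.
move=> tE h0 uq.
have -> : t + h = j.+2%:R * h by rewrite tE -[j.+2]addn1 natrD mulrDl mul1r.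
by have := S_natD j h0 uq; rewrite -tE.
Qed.

(** Weighting the level by e^(omega t) absorbs the L^oo Lipschitz constant, so [lam] stays the same
    along the flow. *)
Lemma truncated_smoothing_natD (t h lam Y : R) (j : nat) (u : T -> R) :
  t = j.+1%:R * h -> 0 < h -> omega * h <= 1 -> u \in Lq -> 0 <= lam -> 0 <= Y ->
  (\int[mu]_x
     (Num.max (`|S t u x - u0 x| - expR (omega * t) * lam) 0 `^ q)%:E <= Y%:E)%E ->
  (\int[mu]_x
     (Num.max (`|S (t + h) u x - u0 x| - expR (omega * (t + h)) * lam) 0 `^ r)%:E <=
   (M `^ r * h `^ (- (al * r)) * Y `^ (gamma * r / q))%:E)%E.
Proof.
move=> tE h0 oh uq l0 Y0 tY.
have t0 : 0 < t by rewrite tE mulr_gt0// ltr0n.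
have th0 : 0 < t + h by rewrite addr_gt0.
have Suq := S_Lfun t0 uq.
have El0 : 0 <= expR (omega * t) * lam by rewrite mulr_ge0// expR_ge0.
have := truncated_smoothing h0 oh Suq El0 Y0 tY; apply: le_trans.
have SE := semigroup_step tE h0 uq.
rewrite le_eqVlt; apply/orP; left; apply/eqP.
have mu0 := Lfun_measurable u0q.
have mS1 := Lfun_measurable (S_Lfun th0 uq).
have mS2 := Lfun_measurable (S_Lfun h0 Suq).
rewrite mulrA -expRD -mulrDr [h + t]addrC.
apply: ge0_ae_eq_integral => //.
- exact: (measurable_trunc _ r (measurable_funB mS1 mu0)).
- exact: (measurable_trunc _ r (measurable_funB mS2 mu0)).
- by move=> x _; rewrite lee_fin powR_ge0.
- by move=> x _; rewrite lee_fin powR_ge0.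
by apply: filterS SE => x /(_ I) -> _.
Qed.

Variable s : R.
Hypothesis s_ge1 : 1 <= s.
Hypothesis al_gt0 : 0 < al.
Let kappa := gamma * r / q.
Hypothesis kappa_gt1 : 1 < kappa.
(** The powers of the height N met below, q - r from exchanging exponents and (q - s)(kappa - 1)
    from the starting value, add up to -P. *)
Let P := (r - q) + (kappa - 1) * (s - q).

(* De Giorgi iteration along the times t (1 - 2^-(k+1)) and the levels
   delta N (1 - 2^-(k+1)); raising the level trades the exponent r for q since
   the values lie between consecutive level gaps and N. *)
Lemma de_giorgi (delta : R) : 0 < delta -> delta <= 1 ->
  exists2 K : R, 0 < K & forall (t N X : R) (u : T -> R),
    0 < t -> omega * t <= 1 -> u \in Lq -> 0 < N -> 0 < X ->
    (\int[mu]_x (`|u x - u0 x| `^ s)%:E <= X%:E)%E ->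
    (\forall x \ae mu, `|S (t / 2) u x - u0 x| <= expR (omega * (t / 2)) * N) ->
    K * t `^ (- (al * r)) * X `^ (kappa - 1) <= N `^ P ->
    \forall x \ae mu, `|S t u x - u0 x| <= expR (omega * t) * (delta * N).
Proof.
move=> d0 d1.
have q0 : 0 < q by exact: lt_le_trans q_ge1.
have r0 : 0 < r by exact: lt_le_trans r_ge1.
have s0 : 0 < s by exact: lt_le_trans s_ge1.
have k10 : 0 < kappa - 1 by rewrite subr_gt0.
pose D := `|q - r|; pose Ds := `|q - s|.
pose z (k : nat) : R := 2^-1 ^+ k.
have z0 k : 0 < z k by rewrite exprn_gt0// invr_gt0.
have zS k : z k = 2 * z k.+1 by rewrite /z exprS mulrA mulfV ?mul1r.
have z1 k : z k <= 1 by rewrite exprn_ile1// invf_le1// ler1n.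
have zlt1 k : z k.+1 < 1 by rewrite -(ltr_pM2l (ltr0n R 2)) -zS mulr1
    (le_lt_trans (z1 k))// ltr1n.
have znat k : (2 ^ k)%:R * z k = 1 :> R.
  by rewrite natrX -exprMn mulfV// expr1n.
have alr0 : 0 < al * r by rewrite mulr_gt0.
have D0 : 0 <= D by exact: normr_ge0.
(* In step k the level gap costs 2^(D k) and the time step 2^(al r k), up to constants. [ro] solves
   2^(D + al r) ro^kappa = ro, so that the bound Y0 ro^k reproduces itself. *)
pose ro : R := 2 `^ (- ((D + al * r) / (kappa - 1))).
have /andP[ro0 ro1] : 0 < ro < 1.
  by apply: powR_half_lt1; rewrite divr_gt0// ltr_wpDl.
have roE : 2 `^ (D + al * r) * ro `^ kappa = ro.
  rewrite /ro -powRrM -powRD; last by apply/implyP => _; rewrite pnatr_eq0.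
  congr (_ `^ _); field; by rewrite gt_eqF.
(* [A0] is the constant of the recursion, with squares because gap and time step in step k are of
   size 2^-(k+2). [B0] belongs to the starting value: s is exchanged for q across the first gap
   delta N / 2, and e^s bounds the growth in L^s up to t / 2. *)
pose A0 := expR D * delta `^ (- D) * (2 `^ D) ^+ 2 * (M `^ r * (2 `^ (al * r)) ^+ 2).
pose B0 := expR Ds * (delta / 2) `^ (- Ds) * expR s.
have A00 : 0 < A0 by rewrite !mulr_gt0 ?exprn_gt0 ?expR_gt0 ?powR_gt0.
have B00 : 0 < B0 by rewrite !mulr_gt0 ?expR_gt0 ?powR_gt0// divr_gt0.
exists (A0 * B0 `^ (kappa - 1) / ro); first by rewrite divr_gt0// mulr_gt0// powR_gt0.
move=> t N X u t0 ot uq N0 X0 uX halfN KN.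
pose A := A0 * N `^ (q - r) * t `^ (- (al * r)).
pose Y0 := B0 * N `^ (q - s) * X.
have Y00 : 0 < Y0 by apply: mulr_gt0 => //; apply: mulr_gt0 => //; exact: powR_gt0.
(* The smallness condition of the recursion: the assumed lower bound on N^P is this inequality
   solved for N. *)
have small : A * Y0 `^ kappa <= ro * Y0.
  have -> : Y0 `^ kappa = Y0 `^ (kappa - 1) * Y0.
    by rewrite mulrC mulr_powRB1 ?(ltW Y00)// (lt_trans ltr01).
  have YE : Y0 `^ (kappa - 1) =
      B0 `^ (kappa - 1) * N `^ ((q - s) * (kappa - 1)) * X `^ (kappa - 1).
    have BN : 0 <= B0 * N `^ (q - s) by rewrite mulr_ge0 ?powR_ge0// ltW.
    by rewrite (powRM _ BN (ltW X0)) (powRM _ (ltW B00) (powR_ge0 _ _)) -powRrM.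
  rewrite mulrA ler_pM2r// YE /A.
  have -> : A0 * N `^ (q - r) * t `^ (- (al * r)) *
      (B0 `^ (kappa - 1) * N `^ ((q - s) * (kappa - 1)) * X `^ (kappa - 1)) =
      ro * (A0 * B0 `^ (kappa - 1) / ro * t `^ (- (al * r)) * X `^ (kappa - 1)) *
      (N `^ (q - r) * N `^ ((q - s) * (kappa - 1))).
    by field; rewrite gt_eqF.
  rewrite -powRD; last by rewrite (gt_eqF N0) implybT.
  have -> : q - r + (q - s) * (kappa - 1) = - P by rewrite /P; ring.
  by rewrite [N `^ (- P)]powRN ler_pdivrMr ?powR_gt0// ler_pM2l.
pose tk k := t * (1 - z k.+1); pose hk k := t * z k.+2.
pose lk k := delta * N * (1 - z k.+1).
have tk0 k : 0 < tk k by rewrite mulr_gt0// subr_gt0.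
have tkS k : tk k.+1 = tk k + hk k.
  by rewrite /tk /hk (zS k.+1); ring.
have tk_le k : omega * tk k <= 1.
  apply: le_trans ot; rewrite ler_wpM2l// /tk ler_piMr ?(ltW t0)// gerBl ltW//.
have tk_ge k : 0 <= omega * tk k by rewrite mulr_ge0// ltW.
have hk0 k : 0 < hk k by rewrite mulr_gt0.
have hk_le k : omega * hk k <= 1.
  by apply: le_trans ot; rewrite ler_wpM2l// /hk ler_piMr ?(ltW t0).
have lk0 k : 0 < lk k by rewrite !mulr_gt0// subr_gt0.
(* The times are dyadic, tk k = (2^(k+2) - 2) hk k, so the semigroup law at commensurable times
   applies. *)
have tkE k : exists j, tk k = j.+1%:R * hk k.
  have : (3 <= 2 ^ k.+2)%N by rewrite !expnS mulnA (leq_trans _ (leq_pmulr _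
      _)) ?expn_gt0.
  case E : (2 ^ k.+2)%N => [//|[//|[//|j]]] _; exists j.
  have := znat k.+2; rewrite E /tk /hk (zS k.+1).
  by rewrite -[j.+3]addn2 natrD => jz; rewrite -[X in X - _]jz; ring.
have SM k : measurable_fun setT (S (tk k) u - u0).
  by apply: measurable_funB; [exact: Lfun_measurable (S_Lfun (tk0 k) uq)|exact:
      Lfun_measurable u0q].
have tk0E : tk 0%N = t / 2 by rewrite /tk /z expr1; field.
have lkS k : lk k.+1 - lk k = delta * z k.+2 * N by rewrite /lk (zS k.+1); ring.
have roS k x : 0 <= x -> x <= D + al * r ->
    ((2 `^ x) ^+ k * (Y0 * ro ^+ k) `^ kappa <= Y0 `^ kappa * ro ^+ k).
  move=> x0 xD.
  rewrite powRM ?(ltW Y00) ?exprn_ge0 ?(ltW ro0)//.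
  rewrite (powR_expn _ _ (ltW ro0)).
  rewrite mulrCA -exprMn ler_wpM2l ?powR_ge0//.
  apply: lerXn2r; rewrite ?nnegrE ?mulr_ge0 ?powR_ge0 ?(ltW ro0)//.
  by rewrite -[leRHS]roE ler_wpM2r ?powR_ge0// ler_powR// ler1n.
have roE2 k : ((2 `^ D) ^+ k * (2 `^ (al * r)) ^+ k * (Y0 * ro ^+ k) `^ kappa
    <= Y0 `^ kappa * ro ^+ k).
  rewrite -exprMn -powRD; last by apply/implyP => _; rewrite pnatr_eq0.
  by apply: roS => //; rewrite addr_ge0// ltW.
have step k : (\forall x \ae mu, `|S (tk k) u x - u0 x| <= expR (omega * tk k) * N) /\
  (\int[mu]_x (Num.max (`|S (tk k) u x - u0 x| - expR (omega * tk k) * lk k) 0 `^ q)%:E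
    <= (Y0 * ro ^+ k)%:E)%E.
  elim: k => [|k [IHa IHb]].
    split; first by rewrite tk0E.
    have y01 : 0 <= omega * tk 0%N <= 1 by rewrite tk_ge tk_le.
    have lE : lk 0%N - 0 = delta / 2 * N by rewrite subr0 /lk /z expr1; field.
    have f0 : \forall x \ae mu, `|(S (tk 0%N) u - u0) x| <= expR (omega * tk 0%N) * N.
      by rewrite tk0E.
    have Z0 : 0 <= expR s * X by rewrite mulr_ge0 ?expR_ge0// ltW.
    have d20 : 0 < delta / 2 by rewrite divr_gt0.
    have fZ : (\int[mu]_x (Num.max (`|(S (tk 0%N) u - u0) x| -
        expR (omega * tk 0%N) * 0) 0 `^ s)%:E <= (expR s * X)%:E)%E.
      under eq_integral do rewrite mulr0 subr0 (max_idPl (normr_ge0 _)).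
      have uXs : (Lpnorm mu s%:E (u - u0) <= (X `^ s^-1)%:E)%E.
        by rewrite Lnorm_le_int ?powR_ge0// -powRrM mulVf ?gt_eqF// powRr1// ltW.
      have s1 : (1 <= s%:E)%E by rewrite lee_fin.
      have := S_fixed s1 (tk0 0%N) (powR_ge0 _ _) uq uXs.
      rewrite Lnorm_le_int ?mulr_ge0 ?expR_ge0 ?powR_ge0// => /le_trans; apply.
      rewrite lee_fin powRM ?expR_ge0 ?powR_ge0// -powRrM mulVf ?gt_eqF//
          powRr1 ?(ltW X0)//.
      by rewrite ler_wpM2r ?(ltW X0)// -expRM ler_expR ler_piMl// ltW.
    have := truncated_change_exp (SM 0%N) y01 N0 d20 (lexx _) lE q0 Z0 f0 fZ.
    move=> /le_trans; apply; rewrite lee_fin expr0 mulr1 /Y0 /B0 -/Ds.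
    by rewrite le_eqVlt; apply/orP; left; apply/eqP; ring.
  have [j jE] := tkE k.
  have vq := S_Lfun (tk0 k) uq.
  have SE := semigroup_step jE (hk0 k) uq.
  have fa : \forall x \ae mu, `|(S (tk k.+1) u - u0) x| <= expR (omega * tk k.+1) * N.
    have EN : 0 <= expR (omega * tk k) * N by rewrite mulr_ge0 ?expR_ge0// ltW.
    have vN : (Lpnorm mu +oo (S (tk k) u - u0) <= (expR (omega * tk k) * N)%:E)%E.
      by apply/Lnormy_leP.
    have EEN : 0 <= expR (omega * hk k) * (expR (omega * tk k) * N).
      by rewrite mulr_ge0// expR_ge0.
    have /(Lnormy_leP _ _ EEN) := S_fixed (leey _) (hk0 k) EN vq vN.
    rewrite tkS; apply: filterS2 SE => x /(_ I) + H; move: H => /=.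
    by rewrite !fctE mulrA -expRD -mulrDr [hk k + _]addrC => H ->.
  split; first exact: fa.
  have Yk0 : 0 <= Y0 * ro ^+ k by rewrite mulr_ge0 ?exprn_ge0 ?(ltW Y00)// ltW.
  have := truncated_smoothing_natD jE (hk0 k) (hk_le k) uq (ltW (lk0 k)) Yk0 IHb.
  rewrite -tkS -/kappa; set Z := _ * _ * _ `^ kappa => fZ.
  have Z0 : 0 <= Z by rewrite !mulr_ge0 ?powR_ge0.
  have y01 : 0 <= omega * tk k.+1 <= 1 by rewrite tk_ge tk_le.
  have dz0 : 0 < delta * z k.+2 by rewrite mulr_gt0.
  have := truncated_change_exp (SM k.+1) y01 N0 dz0 (ltW (lk0 k)) (lkS k) q0 Z0 fa fZ.
  move=> /le_trans; apply; rewrite lee_fin -/D /Z /hk.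
  rewrite (powRM _ (ltW d0) (ltW (z0 _))) (powRM _ (ltW t0) (ltW (z0 _))) !half_powRN.
  rewrite [ro ^+ k.+1]exprSr; apply: (@le_trans _ _ (ro * Y0 * ro ^+ k)); last first.
    by rewrite le_eqVlt; apply/orP; left; apply/eqP; ring.
  apply: (@le_trans _ _ (A * (Y0 `^ kappa * ro ^+ k))); last first.
    by rewrite mulrA ler_wpM2r// exprn_ge0// ltW.
  have A_ge0 : 0 <= A by rewrite mulr_ge0 ?powR_ge0// mulr_ge0 ?powR_ge0// ltW.
  have := ler_wpM2l A_ge0 (roE2 k); apply: le_trans.
  rewrite le_eqVlt; apply/orP; left; apply/eqP.
  by rewrite /A /A0 -[k.+2]addn2 !exprD; ring.
(* From each time tk k one step of length t - tk k lands at t itself. The estimate stays in L^r and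
   its right-hand side tends to 0 with k, so the excess over the level vanishes a.e. *)
have final k : (\int[mu]_x (Num.max (`|S t u x - u0 x| - expR (omega * t) *
    (delta * N)) 0 `^ r)%:E
    <= (M `^ r * t `^ (- (al * r)) * 2 `^ (al * r) * Y0 `^ kappa * ro ^+ k)%:E)%E.
  have [_ IHb] := step k.
  have h0 : 0 < t * z k.+1 by rewrite mulr_gt0.
  have oh : omega * (t * z k.+1) <= 1.
    by apply: le_trans ot; rewrite ler_wpM2l// ler_piMr ?(ltW t0).
  have tE : tk k + t * z k.+1 = t by rewrite /tk; ring.
  have [j jE] : exists j, tk k = j.+1%:R * (t * z k.+1).
    have : (2 <= 2 ^ k.+1)%N by rewrite expnS leq_pmulr// expn_gt0.
    case E : (2 ^ k.+1)%N => [//|[//|j]] _; exists j.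
    have := znat k.+1; rewrite E /tk -[j.+2]addn1 natrD => jz.
    by rewrite -[X in X - _]jz; ring.
  have Yk0 : 0 <= Y0 * ro ^+ k by rewrite mulr_ge0 ?exprn_ge0 ?(ltW Y00)// ltW.
  have := truncated_smoothing_natD jE h0 oh uq (ltW (lk0 k)) Yk0 IHb.
  rewrite tE -/kappa => H.
  have mSt : measurable_fun setT (S t u - u0).
    by apply: measurable_funB; [exact: Lfun_measurable (S_Lfun t0 uq)|exact:
        Lfun_measurable u0q].
  apply: (@le_trans _ _ (\int[mu]_x (Num.max (`|S t u x - u0 x| - expR (omega *
      t) * lk k) 0 `^ r)%:E)%E).
    apply: ge0_le_integral => //.
    - by move=> x _; rewrite lee_fin powR_ge0.
    - exact: (measurable_trunc _ r mSt).
    - exact: (measurable_trunc _ r mSt).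
    move=> x _; rewrite lee_fin; apply: ler_powR2; first exact: ltW.
      by rewrite le_max lexx orbT.
    rewrite ge_max; apply/andP; split; last by rewrite le_max lexx orbT.
    rewrite le_max; apply/orP; left; rewrite lerD2l lerN2.
    rewrite ler_wpM2l ?expR_ge0// /lk ler_piMr ?mulr_ge0 ?(ltW d0) ?(ltW N0)//.
    by rewrite gerBl ltW.
  apply: le_trans H _; rewrite lee_fin (powRM _ (ltW t0) (ltW (z0 _))) half_powRN exprS.
  have c0 : 0 <= M `^ r * t `^ (- (al * r)) * 2 `^ (al * r)
      by rewrite !mulr_ge0 ?powR_ge0.
  have alD : al * r <= D + al * r by rewrite lerDr.
  have := ler_wpM2l c0 (roS k _ (ltW alr0) alD).
  by rewrite !mulrA.
have cvg0 : (M `^ r * t `^ (- (al * r)) * 2 `^ (al * r) * Y0 `^ kappa * ro ^+ k)%:E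
    @[k --> \oo] --> 0%E.
  apply/fine_cvgP; split; first exact: nearW.
  rewrite -[X in _ --> X](mulr0 (M `^ r * t `^ (- (al * r)) * 2 `^ (al * r) *
      Y0 `^ kappa)).
  by apply: cvgMr; apply: cvg_expr; rewrite ger0_norm// ltW.
set f := fun x => (Num.max (`|S t u x - u0 x| - expR (omega * t) * (delta * N))
    0 `^ r)%:E.
have f0 x : (0 <= f x)%E by rewrite lee_fin powR_ge0.
have : (\int[mu]_x f x = 0)%E.
  apply/eqP; rewrite eq_le integral_ge0// andbT -(cvg_lim _ cvg0)//.
  apply: lime_ge; first by apply/cvg_ex; eexists; exact: cvg0.
  exact: nearW.
have mf : measurable_fun setT f.
  apply: (measurable_trunc _ r).
  by apply: measurable_funB; [exact: Lfun_measurable (S_Lfun t0 uq)|exact: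
      Lfun_measurable u0q].
have := @ae_eq_integral_abs _ _ _ mu setT measurableT _ mf.
under eq_integral do rewrite gee0_abs//.
move=> [+ _] => /[apply].
apply: filterS => x /(_ I)[/powR_eq0_eq0 H].
by rewrite -subr_le0 -[leRHS]H le_max lexx.
Qed.

Hypothesis P_gt0 : 0 < P.
Let a := al * r / P.
Let gs := s * (kappa - 1) / P.

(* Ns t := K t^-a X^((kappa-1)/P) satisfies delta * Ns (t / 2) = Ns t for
   delta = 2^-a, so de_giorgi propagates the bound max (delta^n L) (Ns t). *)
Lemma bounded_smoothing :
  exists2 K : R, 0 < K & forall (t X L : R) (u : T -> R),
    0 < t -> omega * t <= 1 -> u \in Lq -> 0 < X -> 0 < L ->
    (\int[mu]_x (`|u x - u0 x| `^ s)%:E <= X%:E)%E ->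
    (\forall x \ae mu, `|u x - u0 x| <= L) ->
    \forall x \ae mu, `|S t u x - u0 x| <=
      expR (omega * t) * (K * t `^ (- a) * X `^ ((kappa - 1) / P)).
Proof.
have r0 : 0 < r by exact: lt_le_trans r_ge1.
have a0 : 0 < a by rewrite divr_gt0// mulr_gt0.
pose delta : R := 2 `^ (- a).
have /andP[d0 d1] : 0 < delta < 1 by exact: powR_half_lt1.
have [K K0 DG] := de_giorgi d0 (ltW d1).
exists (K `^ P^-1); first by rewrite powR_gt0.
move=> t X L u t0 ot uq X0 L0 uX uL.
pose Ns y := K `^ P^-1 * y `^ (- a) * X `^ ((kappa - 1) / P).
have Ns0 y : 0 < y -> 0 < Ns y by move=> y0; rewrite !mulr_gt0 ?powR_gt0.
have NsP y : 0 < y -> Ns y `^ P = K * y `^ (- (al * r)) * X `^ (kappa - 1).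
  move=> y0; rewrite /Ns powRM ?mulr_ge0 ?powR_ge0// powRM ?powR_ge0//.
  rewrite -!powRrM mulVf ?gt_eqF// powRr1 ?(ltW K0)// mulNr /a !divfK// ?gt_eqF//.
have Ns2 y : 0 < y -> delta * Ns (y / 2) = Ns y.
  move=> y0; rewrite /Ns (powRM _ (ltW y0)) ?invr_ge0//.
  have -> : 2^-1 `^ (- a) = 2 `^ a :> R.
    by have := half_powRN 1 a; rewrite !expr1.
  rewrite /delta powRN; field.
  by rewrite gt_eqF// powR_gt0.
have iter n : forall y, 0 < y -> omega * y <= 1 ->
    \forall x \ae mu, `|S y u x - u0 x| <=
      expR (omega * y) * Num.max (delta ^+ n * L) (Ns y).
  elim: n => [|n IH] y y0 oy.
    have /(Lnormy_leP _ _ (ltW L0)) uL' : \forall x \ae mu, `|(u - u0) x| <= L by [].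
    have EL : 0 <= expR (omega * y) * L by rewrite mulr_ge0 ?expR_ge0// ltW.
    have /(Lnormy_leP _ _ EL) := S_fixed (leey _) y0 (ltW L0) uq uL'.
    apply: filterS => x; rewrite !fctE => /le_trans; apply.
    by rewrite expr0 mul1r ler_wpM2l ?expR_ge0// le_max lexx.
  have y20 : 0 < y / 2 by rewrite divr_gt0.
  have oy2 : omega * (y / 2) <= 1.
    by apply: le_trans oy; rewrite ler_wpM2l// ler_pdivrMr// ler_peMr ?(ltW y0)// ler1n.
  have N0 : 0 < Num.max (delta ^+ n * L) (Ns (y / 2)).
    by rewrite lt_max Ns0// orbT.
  have := DG y _ X u y0 oy uq N0 X0 uX (IH _ y20 oy2).
  rewrite (maxr_pMr _ _ (ltW d0)) mulrA -exprS Ns2//; apply.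
  rewrite -NsP//; apply: ler_powR2; rewrite ?(ltW P_gt0) ?(ltW (Ns0 _ y0))//.
  by rewrite le_max -(Ns2 _ y0) ler_piMl ?orbT ?(ltW d1)// ltW// Ns0.
(* The height L of the datum enters only through delta^n L, so enough halvings make the bound
   independent of L, as the later approximation by bounded data requires. *)
have [n nL] : exists n, delta ^+ n * L <= Ns t.
  have H : delta ^+ n * L @[n --> \oo] --> 0.
    rewrite -[X in _ --> X](mul0r L).
    by apply: cvgMl; apply: cvg_expr; rewrite ger0_norm// ltW.
  have [n] := filter_ex (cvgr_lt _ H _ (Ns0 _ t0)).
  by move=> /ltW nL; exists n.
apply: filterS (iter n t t0 ot) => x; rewrite (max_idPr _)//.
Qed.

(** Time is cut into n + 1 pieces of length h with omega h <= 1, where n is the integer part of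
    omega t; only the last piece smooths. Since h^(-a) = t^(-a) (n + 1)^a, a polynomial factor in
    omega t appears besides e^(omega gs t), and the strict inequality gs < b leaves an exponential
    to absorb it. *)
Lemma bounded_smoothing_all_times (b : R) : gs < b ->
  exists2 K : R, 0 < K & forall (t c L : R) (u : T -> R),
    0 < t -> u \in Lq -> 0 < c -> 0 < L ->
    (Lpnorm mu s%:E (u - u0) <= c%:E)%E ->
    (\forall x \ae mu, `|u x - u0 x| <= L) ->
    \forall x \ae mu, `|S t u x - u0 x| <=
      K * t `^ (- a) * expR (omega * b * t) * c `^ gs.
Proof.
move=> gsb.
have r0 : 0 < r by exact: lt_le_trans r_ge1.
have s0 : 0 < s by exact: lt_le_trans s_ge1.
have a0 : 0 < a by rewrite divr_gt0// mulr_gt0.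
have e0 : 0 < b - gs by rewrite subr_gt0.
have [K K0 BS] := bounded_smoothing.
pose K' := expR 1 * K * ((a / (b - gs)) `^ a * expR (b - gs)).
have ae0 : 0 < a / (b - gs) by rewrite divr_gt0.
have K'0 : 0 < K'.
  by apply: mulr_gt0; apply: mulr_gt0; rewrite ?expR_gt0 ?powR_gt0.
exists K' => // t c L u t0 uq c0 L0 uc uL.
have ot0 : 0 <= omega * t by rewrite mulr_ge0// ltW.
set n := Num.trunc (omega * t).
have nle : n%:R <= omega * t by rewrite Num.Theory.truncn_le.
have ltn : omega * t < n.+1%:R by exact: Num.Theory.truncnS_gt.
pose h := t / n.+1%:R.
have n10 : 0 < n.+1%:R :> R by rewrite ltr0n.
have h0 : 0 < h by rewrite divr_gt0.
have oh : omega * h <= 1 by rewrite mulrA ler_pdivrMr// mul1r ltW.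
have hE : n.+1%:R * h = t by rewrite mulrC divfK// gt_eqF.
have E1 : 1 <= expR (omega * t) by rewrite -expR0 ler_expR.
have [v [vq vc vL SE]] : exists v, [/\ v \in Lq,
    (Lpnorm mu s%:E (v - u0) <= (expR (omega * t) * c)%:E)%E,
    (\forall x \ae mu, `|v x - u0 x| <= expR (omega * t) * L) &
    S t u = S h v %[ae mu]].
  move: hE; case: n {nle ltn n10} @h h0 oh => [|j] h h0 oh hE.
    exists u; split => //.
    - by apply: le_trans uc _; rewrite lee_fin ler_peMl// ltW.
    - by apply: filterS uL => x /le_trans; apply; rewrite ler_peMl// ltW.
    - by apply: nearW => x _; rewrite -hE mul1r.
  have jh0 : 0 < j.+1%:R * h by rewrite mulr_gt0.
  have jht : expR (omega * (j.+1%:R * h)) <= expR (omega * t).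
    by rewrite ler_expR ler_wpM2l// -hE ler_wpM2r ?(ltW h0)// ler_nat.
  exists (S (j.+1%:R * h) u); split.
  - exact: S_Lfun.
  - have s1 : (1 <= s%:E)%E by rewrite lee_fin.
    apply: le_trans (S_fixed s1 jh0 (ltW c0) uq uc) _.
    by rewrite lee_fin ler_wpM2r// ltW.
  - have /(Lnormy_leP _ _ (ltW L0)) uL' : \forall x \ae mu, `|(u - u0) x| <= L by [].
    have EL : 0 <= expR (omega * (j.+1%:R * h)) * L by rewrite mulr_ge0 ?expR_ge0// ltW.
    have /(Lnormy_leP _ _ EL) := S_fixed (leey _) jh0 (ltW L0) uq uL'.
    apply: filterS => x; rewrite !fctE => /le_trans; apply.
    by rewrite ler_wpM2r// ltW.
  - by have := S_natD j h0 uq; rewrite hE.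
have Ec0 : 0 < expR (omega * t) * c by rewrite mulr_gt0 ?expR_gt0.
have X0 : 0 < (expR (omega * t) * c) `^ s by rewrite powR_gt0.
have EL0 : 0 < expR (omega * t) * L by rewrite mulr_gt0 ?expR_gt0.
have vX : (\int[mu]_x (`|v x - u0 x| `^ s)%:E <= ((expR (omega * t) * c) `^ s)%:E)%E.
  by move: vc; rewrite Lnorm_le_int// ltW.
apply: filterS2 SE (BS h _ _ v h0 oh vq X0 EL0 vX vL) => x /(_ I) -> /le_trans; apply.
have gsE : s * ((kappa - 1) / P) = gs by rewrite /gs mulrA.
rewrite -powRrM gsE powRM ?expR_ge0 ?(ltW c0)// -expRM.
have -> : expR (omega * h) * (K * h `^ (- a) * (expR (omega * t * gs) * c `^ gs)) =
    expR (omega * h) * (K * h `^ (- a)) * expR (omega * t * gs) * c `^ gs by ring.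
have hta : h `^ (- a) <= t `^ (- a) * ((a / (b - gs)) `^ a * expR ((b - gs) *
    (1 + omega * t))).
  rewrite (powRM _ (ltW t0)) ?invr_ge0 ?(ltW n10)// ler_wpM2l ?powR_ge0//.
  have -> : n.+1%:R^-1 `^ (- a) = n.+1%:R `^ a.
    by rewrite -(powR_inv1 (ltW n10)) -powRrM mulN1r opprK.
  apply: le_trans (powR_le_expR _ a0 e0); last by rewrite ltr_wpDr.
  by apply: ler_powR2; rewrite ?(ltW a0)// -natr1 addrC lerD2l.
rewrite ler_wpM2r ?powR_ge0//.
apply: (@le_trans _ _ (expR 1 * (K * (t `^ (- a) * ((a / (b - gs)) `^ a * expR
    ((b - gs) * (1 + omega * t)))))  * expR (omega * t * gs))).
  rewrite ler_wpM2r ?expR_ge0//.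
  apply: ler_pM; rewrite ?expR_ge0 ?mulr_ge0 ?powR_ge0 ?(ltW K0)//.
    by rewrite ler_expR.
  by rewrite ler_pM2l.
have -> : expR (omega * b * t) = expR ((b - gs) * (omega * t)) * expR (omega * t * gs).
  by rewrite -expRD; congr expR; ring.
have -> : expR ((b - gs) * (1 + omega * t)) =
    expR (b - gs) * expR ((b - gs) * (omega * t)).
  by rewrite -expRD; congr expR; ring.
rewrite /K'.
by rewrite le_eqVlt; apply/orP; left; apply/eqP; ring.
Qed.

End truncation.

(** * Approximation by bounded data and the extension to L^s *)

Section density.
Context {d : measure_display} {T : measurableType d} {R : realType}.
Variable mu : {measure set T -> \bar R}.
Variables (q s : R).
Hypothesis q_ge1 : 1 <= q.
Hypothesis s_ge1 : 1 <= s.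

(** Large values obstruct membership in L^q when q > s, small ones when q < s on a space of infinite
    measure; removing both serves every pair of exponents. *)
Definition cutoff (n : nat) (x : R) : R :=
  if (n.+1%:R^-1 <= `|x|) && (`|x| <= n.+1%:R) then x else 0.

Lemma norm_cutoff_le (n : nat) (x : R) : `|cutoff n x| <= `|x|.
Proof. by rewrite /cutoff; case: ifP => // _; rewrite normr0. Qed.

Lemma norm_cutoff_le_nat (n : nat) (x : R) : `|cutoff n x| <= n.+1%:R.
Proof. by rewrite /cutoff; case: ifP => [/andP[]//|_]; rewrite normr0. Qed.

Lemma cutoff_near (x : R) : \forall n \near \oo, cutoff n x = x.
Proof.
have [->|x0] := eqVneq x 0; first by apply: nearW => n; rewrite /cutoff; case: ifP.
have nx : 0 < `|x| by rewrite normr_gt0.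
near=> n.
have n1 : `|x| <= n%:R by near: n; exact: nbhs_infty_ger.
have n2 : `|x|^-1 <= n%:R by near: n; exact: nbhs_infty_ger.
have nS : n%:R <= n.+1%:R :> R by rewrite ler_nat.
rewrite /cutoff (le_trans n1 nS) andbT ifT// invf_ple ?posrE ?ltr0n//.
exact: le_trans n2 nS.
Unshelve. all: by end_near. Qed.

Lemma measurable_cutoff (n : nat) (f : T -> R) : measurable_fun setT f ->
  measurable_fun setT (cutoff n \o f).
Proof.
move=> mf; apply: (measurableT_comp _ mf).
apply: measurable_fun_ifT => //; apply: measurable_and.
  by apply: measurable_fun_ler => //; exact: measurable_cst.
by apply: measurable_fun_ler.
Qed.

Lemma cutoff_Lfun (n : nat) (w : T -> R) : w \in Lfun mu s%:E ->
  cutoff n \o w \in Lfun mu q%:E /\ cutoff n \o w \in Lfun mu s%:E.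
Proof.
move=> ws; have mw := Lfun_measurable ws.
have q0 : 0 < q by exact: lt_le_trans q_ge1.
have s0 : 0 < s by exact: lt_le_trans s_ge1.
have mc := measurable_cutoff n mw.
have wfin : (\int[mu]_x (`|w x| `^ s)%:E < +oo)%E.
  by rewrite -Lnorm_lty_int//; exact: Lfun_norm_lty.
split; (apply: LfunI; first exact: mc); rewrite (Lnorm_lty_int _ _ _);
    [|exact: q0| |exact: s0]; last first.
  apply: le_lt_trans wfin; apply: ge0_le_integral => //.
  - exact: (measurable_norm_powR s mc).
  - exact: (measurable_norm_powR s mw).
  by move=> x _; rewrite lee_fin ler_powR2// ?(ltW s0)// norm_cutoff_le.
have N0 : 0 < n.+1%:R :> R by rewrite ltr0n.
(* The ratio of the lower to the upper threshold of the cutoff. *)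
pose eta : R := (n.+1%:R^-1) ^+ 2; have eta0 : 0 < eta by rewrite exprn_gt0// invr_gt0.
pose c := n.+1%:R `^ (q - s) * eta `^ (- `|q - s|).
have c0 : 0 <= c by rewrite mulr_ge0 ?powR_ge0.
apply: (@le_lt_trans _ _ (c%:E * \int[mu]_x (`|w x| `^ s)%:E)%E); last first.
  by rewrite lte_mul_pinfty// ?lee_fin.
rewrite -ge0_integralZl_EFin//; last exact: (measurable_norm_powR s mw).
apply: ge0_le_integral => //.
- exact: (measurable_norm_powR q mc).
- by apply: emeasurable_funM => //; exact: (measurable_norm_powR s mw).
move=> x _; rewrite -EFinM lee_fin /= /cutoff.
case: ifPn => [/andP[x1 x2]|_]; last first.
  by rewrite normr0 powR0 ?gt_eqF// mulr_ge0// powR_ge0.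
apply: powR_change_exp => //; rewrite x2 andbT.
by rewrite /eta expr2 -mulrA mulVf ?mulr1// gt_eqF.
Qed.

Lemma Lnorm_cutoff_cvg (w : T -> R) (e : R) : w \in Lfun mu s%:E -> 0 < e ->
  \forall n \near \oo, (Lpnorm mu s%:E ((cutoff n \o w) - w) <= e%:E)%E.
Proof.
move=> ws e0; have mw := Lfun_measurable ws.
have s0 : 0 < s by exact: lt_le_trans s_ge1.
have mc n : measurable_fun setT ((cutoff n \o w) - w).
  by apply: measurable_funB => //; exact: measurable_cutoff.
pose f n x := (`|((cutoff n \o w) - w) x| `^ s)%:E.
have fle n x : (`|f n x| <= (`|w x| `^ s)%:E)%E.
  rewrite gee0_abs ?lee_fin ?powR_ge0// ler_powR2// ?(ltW s0)//.
  rewrite !fctE /= /cutoff; case: ifP => _; first by rewrite subrr normr0.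
  by rewrite sub0r normrN.
have fcvg : {ae mu, forall x, setT x -> f n x @[n --> \oo] --> cst 0%E x}.
  apply: nearW => x _; apply: cvg_near_cst.
  apply: filterS (cutoff_near (w x)) => n.
  by rewrite /f !fctE /= => ->; rewrite subrr normr0 powR0// gt_eqF.
have fdom : {ae mu, forall x n, setT x -> (`|f n x| <= (`|w x| `^ s)%:E)%E}.
  by apply: nearW => x n _.
have [_ _ H] := dominated_convergence measurableT
  (fun n => measurable_norm_powR s (mc n)) (measurable_cst _) fcvg
  (Lfun_integrable s_ge1 ws) fdom.
rewrite integral0 in H.
have es : 0 < e `^ s by rewrite powR_gt0.
have f0 n : (0 <= \int[mu]_x f n x)%E.
  by apply: integral_ge0 => x _; rewrite lee_fin powR_ge0.
have := (ecvg0P f0).1 H _ es.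
by apply: filterS => n; rewrite Lnorm_le_int// ltW.
Qed.

(** The cutoff acts on u - u0 rather than on u, so that the L^s distance to [u0] does not grow. The
    heights L of the approximants are unbounded, but [B] does not depend on L, and the L^oo bound
    survives the L^s limit by lower semicontinuity. *)
Lemma Lipschitz_extension_le (F E : (T -> R) -> (T -> R)) (u0 u : T -> R) (B c : R) :
  Lipschitz_extension mu q s F E -> u0 \in Lfun mu q%:E -> u0 \in Lfun mu s%:E ->
  u \in Lfun mu s%:E -> 0 <= B -> 0 <= c ->
  (Lpnorm mu s%:E (u - u0) <= c%:E)%E ->
  (forall (L : R) v, v \in Lfun mu q%:E -> 0 < L ->
    (Lpnorm mu s%:E (v - u0) <= c%:E)%E ->
    (\forall x \ae mu, `|v x - u0 x| <= L) ->
    \forall x \ae mu, `|F v x - u0 x| <= B) ->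
  (Lpnorm mu +oo (E u - u0) <= B%:E)%E.
Proof.
move=> [Es [L L0 EL] EF] u0q u0s us B0 c0 uc FB.
have s1 : (1 <= s%:E)%E by rewrite lee_fin.
have q1 : (1 <= q%:E)%E by rewrite lee_fin.
pose w := u - u0; have ws : w \in Lfun mu s%:E by exact: LfunB.
pose v n := u0 + (cutoff n \o w).
have vq n : v n \in Lfun mu q%:E by apply: LfunD => //; exact: (cutoff_Lfun n ws).1.
have vs n : v n \in Lfun mu s%:E by apply: LfunD => //; exact: (cutoff_Lfun n ws).2.
have vu0 n : v n - u0 = cutoff n \o w by rewrite /v addrAC subrr add0r.
have vu n : v n - u = (cutoff n \o w) - w by rewrite /v /w opprB addrCA addrA.
have mEu := Lfun_measurable (Es _ us).
have mEv n := Lfun_measurable (Es _ (vs n)).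
have mu0 := Lfun_measurable u0q.
apply: (@Lnorm_lsc _ _ _ mu s _ _ (fun n => E (v n) - u0)) => //.
- exact: leey.
- exact: (measurable_funB mEu mu0).
- apply: nearW => n; split; first exact: (measurable_funB (mEv n) mu0).
  apply/Lnormy_leP => //.
  have N0 : 0 < n.+1%:R :> R by rewrite ltr0n.
  have := FB n.+1%:R (v n) (vq n) N0.
  have vc : (Lpnorm mu s%:E (v n - u0) <= c%:E)%E.
    rewrite vu0; apply: le_Lnorm uc => //.
    + exact: measurable_cutoff (Lfun_measurable ws).
    + exact: Lfun_measurable ws.
    + by apply: nearW => x; exact: norm_cutoff_le.
  move=> /(_ vc); have vn : \forall x \ae mu, `|v n x - u0 x| <= n.+1%:R.
    apply: nearW => x; have -> : v n x - u0 x = cutoff n (w x)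
        by rewrite -[LHS]/((v n - u0) x) vu0.
    exact: norm_cutoff_le_nat.
  move=> /(_ vn); apply: filterS2 (EF _ (vq n) (vs n)) => x /(_ I).
  by rewrite !fctE => ->.
- move=> e e0; have eL : 0 < e / (L + 1) by rewrite divr_gt0// ltr_wpDl.
  apply: filterS (Lnorm_cutoff_cvg ws eL) => n; rewrite -vu => vue.
  have -> : (E (v n) - u0) - (E u - u0) = E (v n) - E u by rewrite opprB addrA subrK.
  apply: le_trans (EL _ _ (vs n) us) _.
  apply: (@le_trans _ _ (L%:E * (e / (L + 1))%:E)%E).
    by apply: lee_wpmul2l.
  rewrite -EFinM lee_fin mulrA ler_pdivrMr ?ltr_wpDl// mulrC ler_pM2l//.
  by rewrite lerDl.
Qed.

End density.

(* 1 - gamma_star (1 - theta) = P / (kappa D) with kappa = gamma r / q: hence m0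
   cancels out of alpha_s and gamma_s and only enters beta_s. *)
Lemma exponentsE (R : realFieldType) (q r sigma gamma m0 s : R) :
  1 <= q -> 0 < sigma -> 0 < gamma -> q < gamma * r -> q / gamma <= m0 ->
  let D := (gamma * r / q - 1) * m0 + q * (1 / gamma - 1) in
  0 < D -> 1 <= s ->
  let alpha_star := q / (sigma * gamma) / D in
  let beta_star := (gamma ^+ 2 * r / q - 1) / D + 1 in
  let gamma_star := (gamma * r / q - 1) * m0 / D in
  let theta := s * q / (gamma * r * m0) in
  let E := 1 - gamma_star * (1 - theta) in
  let P := r - q + (gamma * r / q - 1) * (s - q) in
  0 < E ->
  [/\ 0 < P, alpha_star / E = 1 / sigma * r / P,
      gamma_star * theta / E = s * (gamma * r / q - 1) / P &
      s * (gamma * r / q - 1) / P < (beta_star / 2 + gamma_star * theta) / E].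
Proof.
move=> q1 sg g0 qgr qm0 D D0 s1 al be gs th E P E0.
have q0 : 0 < q by exact: lt_le_trans q1.
have s0 : 0 < s by exact: lt_le_trans s1.
have m00 : 0 < m0 by apply: lt_le_trans qm0; rewrite divr_gt0.
have r0 : 0 < r by rewrite -(pmulr_rgt0 _ g0) (lt_trans q0).
pose k := gamma * r / q.
have k1 : 1 < k by rewrite /k ltr_pdivlMr// mul1r.
have k0 : 0 < k by rewrite (lt_trans ltr01).
have rE : r = k * q / gamma by rewrite /k; field; rewrite !gt_eqF.
have nz : [/\ q != 0, gamma != 0, m0 != 0, D != 0 & k != 0] by rewrite !gt_eqF.
have [qn gn mn Dn kn] := nz.
have thE : th = s / (k * m0) by rewrite /th /k; field; rewrite gn mn qn gt_eqF.
have gsE : gs = (k - 1) * m0 / D by [].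
have DE : D = (k - 1) * m0 + q * (1 / gamma - 1) by [].
have PE : P = k * D * E.
  rewrite /E thE gsE.
  have -> : k * D * (1 - (k - 1) * m0 / D * (1 - s / (k * m0))) =
      k * D - (k - 1) * (k * m0 - s) by field; rewrite mn Dn kn.
  rewrite /P -/k DE [in LHS]rE.
  by field.
have P0 : 0 < P by rewrite PE; apply: mulr_gt0 => //; exact: mulr_gt0.
have En : E != 0 by rewrite gt_eqF.
have gE : gs * th / E = s * (gamma * r / q - 1) / P.
  rewrite PE -/k gsE thE; field.
  by rewrite mn Dn kn En.
(* beta_s exceeds gamma_s by beta_star / (2 E), so the last claim is the positivity of beta_star. *)
have be0 : 0 < be.
  have -> : be = (gamma * k - 1 + D) / D.
    by rewrite /be /k; field; rewrite qn Dn.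
  rewrite divr_gt0//; have [gk|gk] := leP 1 (gamma * k); first by lra.
  (* In this case m0 >= q / gamma gives D >= (k - 1) q / gamma + 1 - gamma, hence gamma k - 1 + D >=
     (k - 1)(gamma + q / gamma) > 0. *)
  have g1 : gamma < 1 by nra.
  have h1 : q * (1 / gamma - 1) >= 0.
    by rewrite mulr_ge0 ?(ltW q0)// subr_ge0 ler_pdivlMr// mul1r ltW.
  have h2 : (k - 1) * (q / gamma) <= (k - 1) * m0 by rewrite ler_wpM2l// subr_ge0 ltW.
  have h3 : 1 < q / gamma by rewrite ltr_pdivlMr// mul1r; lra.
  have h4 : q * (1 / gamma - 1) = q / gamma - q by field.
  have h5 : 1 / gamma - 1 <= q * (1 / gamma - 1).
    by rewrite ler_peMl// subr_ge0 ler_pdivlMr// mul1r ltW.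
  have h6 : 1 - gamma <= 1 / gamma - 1.
    have -> : 1 / gamma - 1 = (1 - gamma) / gamma by field.
    by rewrite ler_pdivlMr// ler_piMr// ?subr_ge0 ltW.
  rewrite DE; nra.
split => //.
- rewrite PE [in RHS]rE /al; field.
  by rewrite gn Dn kn En gt_eqF.
- rewrite -gE ltr_pM2r ?invr_gt0// ltrDr divr_gt0//.
Qed.

Unset Implicit Arguments.
Set Strict Implicit.

Theorem theorem1p4 (R : realType) (d : measure_display) (T : measurableType d)
    (mu : {sigma_finite_measure set T -> \bar R})
    (q omega : R) (A : set ((T -> R) * (T -> R)))
    (r : \bar R) (rho sigma C : R) (u0 : T -> R)
    (S : R -> (T -> R) -> (T -> R)) :
  1 <= q -> 0 <= omega ->
  operator_on mu q A -> densely_defined mu q A ->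
  m_completely_accretive mu q (addI omega A) ->
  (1 <= r)%E -> 0 <= rho -> 0 < sigma -> 0 < C ->
  u0 \in Lfun mu 1 -> u0 \in Lfun mu +oo -> A (u0, cst 0) ->
  (forall u v : T -> R, A (u, v) ->
     (Lpnorm mu r (u - u0) `^ sigma <=
        C%:E * ((bracket mu q (u - u0) v)%:E +
                omega%:E * Lpnorm mu q%:E (u - u0) `^ q) *
        Lpnorm mu q%:E (u - u0) `^ rho)%E) ->
  semigroup_generated_by mu q A S ->
  let alpha := 1 / sigma in
  let gamma := (q + rho) / sigma in
  let beta := gamma + 1 in
  (forall (t : R) (u : T -> R), 0 < t -> u \in Lfun mu q%:E ->
     (Lpnorm mu r (S t u - u0) <=
        ((C / q) `^ (1 / sigma) * t `^ (- alpha) *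
           expR (omega * beta * t))%:E *
        Lpnorm mu q%:E (u - u0) `^ gamma)%E) /\
  (forall r' : R, r = r'%:E -> q < gamma * r' ->
   forall m0 : R, q / gamma <= m0 ->
   let D := (gamma * r' / q - 1) * m0 + q * (1 / gamma - 1) in
   0 < D ->
   let alpha_star := (q / (sigma * gamma)) / D in
   let beta_star := (gamma ^+ 2 * r' / q - 1) / D + 1 in
   let gamma_star := (gamma * r' / q - 1) * m0 / D in
   forall s : R, 1 <= s -> s <= gamma * r' / q * m0 ->
   let theta := s * q / (gamma * r' * m0) in
   gamma_star * (1 - theta) < 1 ->
   let alpha_s := alpha_star / (1 - gamma_star * (1 - theta)) in
   let beta_s := (beta_star / 2 + gamma_star * theta) /
                 (1 - gamma_star * (1 - theta)) in
   let gamma_s := gamma_star * theta / (1 - gamma_star * (1 - theta)) in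
   exists2 K : R, 0 < K &
     forall (t : R) (St : (T -> R) -> (T -> R)) (u : T -> R),
       0 < t -> Lipschitz_extension mu q s (S t) St -> u \in Lfun mu s%:E ->
       (Lpnorm mu +oo (St u - u0) <=
          (K * t `^ (- alpha_s) * expR (omega * beta_s * t))%:E *
          Lpnorm mu s%:E (u - u0) `^ gamma_s)%E).
Proof.
move=> q1 om0 opA domA [opB caA _] r1 rho0 sg0 C0 u01 u0oo Au0 GN genS al ga be.
have q0 : 0 < q by exact: lt_le_trans q1.
have ga0 : 0 < ga by rewrite divr_gt0// ltr_pwDl.
have u0q : u0 \in Lfun mu q%:E by have [] := opA.1 _ _ Au0.
have smooth := semigroup_smoothing q1 om0 opA domA caA r1 rho0 sg0 C0 Au0 GN genS.
split => [t u t0 uq|r' rE qgr m0 qm0 D D0 als bes gas s s1 sm th E0 a_s b_s g_s].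
  have uu0 : u - u0 \in Lfun mu q%:E by apply: LfunB; rewrite ?lee_fin.
  rewrite -(Lfun_norm_fineK uu0) poweR_EFin -EFinM.
  apply: le_trans (smooth t u t0 uq) _.
  by rewrite lee_fin le_eqVlt; apply/orP; left; apply/eqP; rewrite -/al -/ga -/be; ring.
have r'1 : 1 <= r' by rewrite -lee_fin -rE.
rewrite {}rE in r1 GN smooth *.
have E0' : 0 < 1 - gas * (1 - th) by rewrite subr_gt0.
have [P0 aE gE gb] := exponentsE q1 sg0 ga0 qgr qm0 D0 s1 E0'.
(* For omega t <= 1 the factor e^(omega beta t) is at most e^beta. *)
pose M := (C / q) `^ (1 / sigma) * expR be.
have M0 : 0 < M by rewrite mulr_gt0 ?expR_gt0// powR_gt0// divr_gt0.
have al0 : 0 < al by rewrite divr_gt0.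
have kap : 1 < ga * r' / q by rewrite ltr_pdivlMr// mul1r.
have smooth' t u : 0 < t -> omega * t <= 1 -> u \in Lfun mu q%:E ->
    (Lpnorm mu r'%:E (S t u - u0) <=
      (M * t `^ (- al) * fine (Lpnorm mu q%:E (u - u0)) `^ ga)%:E)%E.
  move=> t0 ot uq; apply: le_trans (smooth t u t0 uq) _.
  rewrite lee_fin mulrA ler_wpM2r ?powR_ge0// mulrA ler_wpM2r ?powR_ge0//.
  rewrite mulrC ler_wpM2l ?powR_ge0// ler_expR mulrAC ler_piMl//.
  by rewrite addr_ge0// ltW.
have [K K0 HK] := bounded_smoothing_all_times q1 r'1 om0 ga0 M0 u0q
  (fun t u t0 uq => semigroup_Lfun domA genS t0 uq)
  (fun t c u u' t0 c0 uq u'q => semigroup_contraction q1 om0 opA caA domA genS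
     t0 (leey _) c0 uq u'q)
  smooth'
  (fun p t c u p1 t0 c0 uq => semigroup_contraction_fixed q1 om0 opA caA domA
     genS Au0 t0 p1 c0 uq)
  (fun h j u h0 uq => semigroup_natD q1 om0 opA caA domA genS j h0 uq)
  s1 al0 kap P0 gb.
exists K => // t E u t0 ext us.
have u0s : u0 \in Lfun mu s%:E by exact: Lfun1_oo.
have uu0 : u - u0 \in Lfun mu s%:E by apply: LfunB; rewrite ?lee_fin.
rewrite -(Lfun_norm_fineK uu0) poweR_EFin -EFinM.
set c := fine _; have c0 : 0 <= c by exact: fine_Lnorm_ge0.
have uc : (Lpnorm mu s%:E (u - u0) <= c%:E)%E by rewrite Lfun_norm_fineK.
pose B := K * t `^ (- a_s) * expR (omega * b_s * t).
have B0 : 0 < B by rewrite mulr_gt0 ?expR_gt0// mulr_gt0// powR_gt0.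
have key c' : 0 < c' -> c <= c' ->
    (Lpnorm mu +oo (E u - u0) <= (B * c' `^ g_s)%:E)%E.
  move=> c'0 cc'; have uc' : (Lpnorm mu s%:E (u - u0) <= c'%:E)%E.
    by apply: le_trans uc _; rewrite lee_fin.
  apply: (Lipschitz_extension_le q1 s1 ext u0q u0s us _ (ltW c'0) uc').
    by rewrite mulr_ge0 ?powR_ge0// ltW.
  move=> L v vq L0 vc vL; have := HK t c' L v t0 vq c'0 L0 vc vL.
  by rewrite /B /a_s /b_s /g_s aE gE.
have [c_gt0|] := ltP 0 c; first exact: key.
move=> cle0; have cz : c = 0 by apply/eqP; rewrite eq_le cle0.
have gs0 : 0 < g_s.
  by rewrite /g_s gE divr_gt0// mulr_gt0 ?subr_gt0// (lt_le_trans ltr01).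
rewrite cz powR0 ?gt_eqF// mulr0; apply/lee_addgt0Pr => e e0; rewrite add0e.
(* [key] asks for a positive bound on the distance; when the distance is 0, this one makes the
   right-hand side equal to the arbitrary e. *)
have e1 : 0 < (e / B) `^ g_s^-1 by rewrite powR_gt0// divr_gt0.
apply: le_trans (key _ e1 _) _; first by rewrite cz ltW.
rewrite lee_fin -powRrM mulVf ?gt_eqF// powRr1 ?divr_ge0 ?(ltW e0) ?(ltW B0)//.
by rewrite mulrC divfK// gt_eqF.
Qed.
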